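(* Let $P,Q\in\mathbb{C}[x,y]$ be polynomials of degree $m>1$ without a common nonconstant polynomial factor, and let $C$ be an algebraic invariant curve of the system $\dot x=P(x,y)$, $\dot y=Q(x,y)$, with defining polynomial $f(x,y)$ of degree $n$. Suppose that there exists an integer $K$ such that $\left(f,\frac{\partial f}{\partial y}\right)_X\leq K$ for all $X\in\mathrm{Sing}(C)$. Then the following estimate for the degree of the curve $C$ holds: $$n\leq\frac{4+2m+K+\left((4+2m+K)^2+16Km^2\right)^{1/2}}{4}.$$
   Context: An algebraic invariant curve of the system is the curve $C$ given by $f(x,y)=0$, where $f\in\mathbb{C}[x,y]$ is an irreducible (nonconstant) polynomial such that $P\frac{\partial f}{\partial x}+Q\frac{\partial f}{\partial y}=kf$ for some $k\in\mathbb{C}[x,y]$. The curve is considered in $\mathbb{C}\mathbb{P}^2$ (projective closure), and $\mathrm{Sing}(C)\subset\mathbb{C}\mathbb{P}^2$ is the set of all its singular points, both finite ones and those on the line at infinity. The symbol $(g,l)_X$ denotes the intersection number of the curves $g=0$ and $l=0$ at the point $X$; for $X$ on the line at infinity, $\left(f,\frac{\partial f}{\partial y}\right)_X$ is the intersection number at $X$ of the projective curves $F=0$ and $\frac{\partial F}{\partial y}=0$, where $F(x,y,z)$ is the homogenization of $f$.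
   Formalization: The integer K is assumed nonnegative; for negative K the hypothesis can only hold when Sing(C) is empty, and then the stated inequality is false or has a negative number under the root. *)

(* Defs.v *)
From HB Require Import structures.
From mathcomp Require Import all_boot all_order all_algebra.
From mathcomp Require Import fraction complex.
(* mpoly must come before constructive_ereal: in the other order their
   notations clash. *)
From mathcomp Require Import mpoly.
From mathcomp Require Import boolp reals constructive_ereal.

Set Implicit Arguments.
Unset Strict Implicit.
Unset Printing Implicit Defensive.

Import Order.TTheory GRing.Theory Num.Theory.
Local Open Scope ring_scope.

Local Notation "x %:F" := (tofrac x).

Section AffineIntersection.
Variable C : closedFieldType.
Implicit Types (p q g l : {mpoly C[2]}) (a : 'I_2 -> C).
Implicit Types (h : {fraction {mpoly C[2]}}) (d : nat).

Definition local_ring a h : Prop :=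
  exists p q, q.@[a] != 0 /\ h = p%:F / q%:F.

Definition local_ideal a g l h : Prop :=
  exists u v, [/\ local_ring a u, local_ring a v & h = u * g%:F + v * l%:F].

(* The classes of the e i form a basis of the C-vector space O_a / (g, l) O_a,
   where O_a is the local ring of the affine plane at a. *)
Definition local_quotient_dim a g l d : Prop :=
  exists e : 'I_d -> {fraction {mpoly C[2]}},
    (forall i, local_ring a (e i)) /\
    (forall h, local_ring a h ->
       exists! c : {ffun 'I_d -> C},
         local_ideal a g l (h - \sum_i ((c i)%:MP)%:F * e i)).

(* (g, l)_a = dim_C O_a / (g, l), which is +oo when g and l share a factor
   vanishing at a. *)
Definition intersection_number g l a : \bar int :=
  if pselect (exists d, local_quotient_dim a g l d) is left h
  then (Posz (sval (cid h)))%:E else +oo%E.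

End AffineIntersection.

Section ProjectivePlane.
Variable C : closedFieldType.
Implicit Types (f : {mpoly C[2]}) (F G : {mpoly C[3]}) (X : 'I_3 -> C).

(* A point of CP^2 is given by homogeneous coordinates X = (x : y : z), not all
   zero; every notion below is invariant under rescaling X. The line at
   infinity is z = 0. *)
Definition ix : 'I_3 := ord0.
Definition iy : 'I_3 := inord 1.
Definition iz : 'I_3 := ord_max.

Definition is_proj_point X : Prop := exists i, X i != 0.

(* F(x, y, z) = z^n f(x/z, y/z), where n is the degree of f. *)
Definition homogenize f : {mpoly C[3]} :=
  \sum_(k <- msupp f)
     f@_k *: ('X_ix ^+ k ord0 * 'X_iy ^+ k ord_max
                * 'X_iz ^+ ((msize f).-1 - mdeg k)).

(* Restriction to the affine chart X i != 0, in which the two remaining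
   variables keep their order. *)
Definition dehomogenize (i : 'I_3) F : {mpoly C[2]} :=
  F \mPo [tuple if unlift i j is Some k then 'X_k else 1 | j < 3].

Definition chart (i : 'I_3) X : 'I_2 -> C := fun k => X (lift i k) / X i.

(* The value does not depend on the chart containing X. *)
Definition proj_intersection_number F G X : \bar int :=
  if [pick i | X i != 0] is Some i
  then intersection_number (dehomogenize i F) (dehomogenize i G) (chart i X)
  else +oo%E.

Definition Sing f X : Prop :=
  let F := homogenize f in
  [/\ is_proj_point X, F.@[X] = 0 & forall i, (F^`M(i)).@[X] = 0].

(* (f, df/dy)_X for X in CP^2: affine curves at a finite point, projective ones
   on the line at infinity. *)
Definition f_fy_number f X : \bar int :=
  if X iz != 0
  then intersection_number f (f^`M(ord_max)) (chart iz X)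
  else proj_intersection_number (homogenize f) ((homogenize f)^`M(iy)) X.

End ProjectivePlane.

Section InvariantCurves.
Variable C : closedFieldType.
Implicit Types (P Q f g h k u v : {mpoly C[2]}).

Definition nonconstant f : bool := (1 < msize f)%N.

(* msize is the degree plus one, and 0 for the zero polynomial. *)
Definition has_degree f (n : nat) : bool := msize f == n.+1.

Definition mirreducible f : Prop :=
  nonconstant f /\
  forall g h, f = g * h -> g \is a GRing.unit \/ h \is a GRing.unit.

Definition no_common_factor P Q : Prop :=
  forall g u v, P = g * u -> Q = g * v -> ~~ nonconstant g.

Definition invariant_curve P Q f : Prop :=
  mirreducible f /\
  exists k, P * f^`M(ord0) + Q * f^`M(ord_max) = k * f.

End InvariantCurves.

(* Main.v *)
Require Import Defs.
From HB Require Import structures.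
From mathcomp Require Import all_boot all_order all_algebra.
From mathcomp Require Import fraction complex.
From mathcomp Require Import mpoly.
From mathcomp Require Import boolp reals constructive_ereal.
From mathcomp Require Import ring lra zify.

Set Implicit Arguments.
Unset Strict Implicit.
Unset Printing Implicit Defensive.

Import Order.TTheory GRing.Theory Num.Theory.
Local Open Scope ring_scope.

(** The bound says that [2 n^2 - (4 + 2 m + K) n <= 2 K m^2], that is,
    [n (n - 1) <= n (m + 1) + K (m^2 + n / 2)].

    By Bezout's theorem, [n (n - 1)] is the total intersection number of the
    projective curves [F = 0] and [F_y = 0]. Each singular point of the curve
    contributes at most [K]. There are at most [m^2 + n / 2] of them: a finite one
    is a common zero of [P] and [Q], as the curve is smooth where the vector field
    does not vanish ([finite_singular_stationary], [bezout_bound]), and one at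
    infinity is a double point of the intersection of the curve with the line at
    infinity ([singular_at_infinity_bound]). At a smooth point, let
    [H = z P(x, y, z)], a form of degree [m + 1]. Invariance and Euler's identity
    show that [H F_x], [H F_y] and [H F_z] belong to the ideal [(F, F_y)]
    ([residual_partial]); one of the partial derivatives being a unit, the
    contribution is at most the one of the curves [F = 0] and [H = 0]. These
    contribute [n (m + 1)] in total, again by Bezout's theorem, because [F]
    divides neither [H] nor [F_y].

    The proof does not add up local multiplicities: it compares all the local
    terms at once, in the graded ring [S = C[x, y, z]] ([residual_bound]). For large [D], exactness of the Koszul complex gives the
    codimensions [n (n - 1)] and [n (m + 1)] of [(F, F_y)_D] and [(F, H)_D]
    ([dim_ideal_part]). Multiplication by [H] induces a map from [S / J], where
    [J = (F, F_y) : H], to [S / (F, F_y)], with cokernel [S / (F, F_y, H)], so that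
    [n (n - 1) <= n (m + 1) + dim (S / J)_D] in large degrees. As [J] contains the
    partial derivatives of [F], its zeros are singular points of the curve, and a
    form belongs to [J] as soon as it belongs to the local ideals of [F] and [F_y]
    at these points; this is at most [K] linear conditions per point
    ([local_quotient_codim]). The passage from local to global membership rests on
    the Nullstellensatz, where a linear form [t] without zeros on [F = F_y = 0]
    plays the role of the line at infinity, and on the fact that such a [t] is
    regular modulo [(F, F_y)] ([linear_form_regular]). Exactness of the Koszul
    complex requires that irreducible polynomials be prime
    ([mirreducible_prime]). *)

(** * Gauss's lemma and prime elements of C[x][y] *)

Section BivariatePrime.
Variable C : closedFieldType.
Implicit Types (a : C) (c : {poly C}) (q r s t f g h d : {poly {poly C}}).

Definition x_minus a : {poly {poly C}} := ('X - a%:P)%:P.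

Lemma x_minus_neq0 a : x_minus a != 0.
Proof. by rewrite polyC_eq0 polyXsubC_eq0. Qed.

Lemma x_minus_dvdP a r :
  (exists r', r = x_minus a * r') <-> map_poly (horner_eval a) r = 0.
Proof.
split=> [[r' ->]|r0].
  by rewrite rmorphM /= map_polyC /= horner_evalE !hornerE subrr mul0r.
exists (map_poly (fun c => c %/ ('X - a%:P)) r).
apply/polyP=> i; rewrite coefCM coef_map_id0 ?div0p // mulrC divpK //.
rewrite dvdp_XsubCl /root.
by have /polyP/(_ i) := r0; rewrite coef_map coef0 /= horner_evalE => ->.
Qed.

Lemma x_minus_prime a t r s : x_minus a * t = r * s ->
  (exists r', r = x_minus a * r') \/ (exists s', s = x_minus a * s').
Proof.
move=> e; have /eqP : map_poly (horner_eval a) (r * s) = 0.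
  by apply/x_minus_dvdP; exists t.
by rewrite rmorphM mulf_eq0 => /orP[] /eqP /x_minus_dvdP; [left|right].
Qed.

Lemma poly_root_ind (P : {poly C} -> Prop) :
  (forall a, a != 0 -> P a%:P) ->
  (forall c a, c != 0 -> P c -> P (c * ('X - a%:P))) ->
  forall c, c != 0 -> P c.
Proof.
move=> Pc PM c; have [n] := ubnP (size c).
elim: n c => // n IH c szc c0.
have [/size_poly1P[a a0 ->]|] := boolP (size c == 1%N); first exact: Pc.
move=> /closed_rootP[a /factor_theorem[c' e]].
move: c0; rewrite e mulf_eq0 negb_or => /andP[c'0 _]; apply: PM => //.
apply: IH => //; move: szc; rewrite e size_Mmonic ?monicXsubC //.
by rewrite size_XsubC addn2.
Qed.

(** Gauss's lemma: as every root [a] of [c] gives a prime [x - a], the factors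
    of [c] can be removed one by one from [q] or from [d]. *)
Lemma polyC_mul_factor c f q d : c != 0 -> c%:P * f = q * d ->
  exists c1 c2 q' d', [/\ c1 != 0, c2 != 0, q = c1%:P * q', d = c2%:P * d'
    & f = q' * d'].
Proof.
move=> c0; move: c c0 q d; apply: poly_root_ind => [a a0|c a c0 IH] q d e.
  exists a%:P, 1, (a^-1%:P%:P * q), d; split; rewrite ?oner_eq0 ?polyC_eq0 //.
  - by rewrite mulrA -!polyCM divff ?mul1r.
  - by rewrite polyC1 mul1r.
  - by rewrite -mulrA -e mulrA -!polyCM mulVf ?mul1r.
have {}e : x_minus a * (c%:P * f) = q * d by rewrite -e polyCM mulrCA mulrA.
case: (x_minus_prime e) => -[r er]; move: e; rewrite er.
  rewrite -mulrA => /(mulfI (x_minus_neq0 a)) /IH[c1 [c2 [q' [d' [c10 c20 -> -> ->]]]]].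
  exists (('X - a%:P) * c1), c2, q', d'; split=> //.
    by rewrite mulf_neq0 // polyXsubC_eq0.
  by rewrite polyCM mulrA.
rewrite [q * _]mulrCA => /(mulfI (x_minus_neq0 a)) /IH[c1 [c2 [q' [d' [c10 c20 -> -> ->]]]]].
exists c1, (('X - a%:P) * c2), q', d'; split=> //.
  by rewrite mulf_neq0 // polyXsubC_eq0.
by rewrite polyCM mulrA.
Qed.

Lemma unit_size f : f \is a GRing.unit -> size f = 1%N.
Proof. by rewrite poly_unitE => /andP[/eqP]. Qed.

Lemma x_minus_nonunit a : x_minus a \isn't a GRing.unit.
Proof.
apply/negP; rewrite poly_unitE coefC /= => /andP[_].
by rewrite poly_unitE size_XsubC.
Qed.

Lemma polyC2_unit (a : C) : a != 0 -> (a%:P%:P : {poly {poly C}}) \is a GRing.unit.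
Proof. by move=> a0; rewrite !rmorph_unit ?unitfE. Qed.

(** If [f] depends on [y], compare [f] and [g] over the field of fractions
    [C(x)]. Either they have a common divisor, necessarily [f] itself, or Bezout's
    identity puts a nonzero [c(x)] in the ideal [(f, g)], so that [f] divides
    [c h]. In both cases Gauss's lemma removes the elements of [C[x]] that were
    introduced as denominators. If [f] does not depend on [y], then it is some
    [x - a] up to a unit. *)
Lemma irreducible_prime_poly2 f g h v : f != 0 -> f \isn't a GRing.unit ->
  (forall q d, f = q * d -> q \is a GRing.unit \/ d \is a GRing.unit) ->
  g * h = v * f -> (exists r, g = r * f) \/ (exists r, h = r * f).
Proof.
move=> f0 fU irr e.
have [szf|szf] := leqP (size f) 1.
  have := size1_polyC szf; set c := f`_0 => fE.
  have c0 : c != 0 by apply: contraNneq f0 => c0; rewrite fE c0 polyC0.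
  have /closed_rootP[a /factor_theorem[c' cE]] : size c != 1.
    by apply: contra fU => /size_poly1P[b b0 cb]; rewrite fE cb polyC2_unit.
  have fE' : f = c'%:P * x_minus a by rewrite fE cE polyCM.
  have c'U : c'%:P \is a GRing.unit.
    by case: (irr _ _ fE') => // /(negP (x_minus_nonunit a)).
  have : x_minus a * (c'%:P * v) = g * h by rewrite e fE'; ring.
  by case/x_minus_prime => -[r ->]; [left|right]; exists (r * c'%:P^-1);
    rewrite fE' mulrA divrK // mulrC.
have constU q : size q = size f -> forall c, f = c%:P * q -> c%:P \is a GRing.unit.
  move=> szq c /irr[//|/(unit_size)]; rewrite szq => sz1.
  by rewrite sz1 in szf.
have szc c q : c != 0 -> size (c%:P * q) = size q.
  by move=> c0; rewrite mul_polyC size_scale.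
have [szg|szg] := leqP (size (gcdp f g)) 1.
  have : coprimep f g.
    by rewrite /coprimep eqn_leq szg lt0n size_poly_eq0 gcdp_eq0 negb_and f0.
  case/Bezout_coprimepP => -[u w] /=; rewrite -size_poly_eq1 => /size_poly1P[c c0 uw].
  right; have /(polyC_mul_factor c0) : c%:P * h = (u * h + w * v) * f.
    by rewrite -uw mulrDl mulrDl -[w * v * f]mulrA -e; ring.
  case=> c1 [c2 [q [d [c10 c20 _ fE ->]]]].
  have /unitrP[c3 [c32 _]] : c2%:P \is a GRing.unit.
    by apply: (constU _ _ _ fE); rewrite fE szc.
  by exists (q * c3); rewrite fE -[RHS]mulrA [c3 * _]mulrA c32 mul1r.
left; have [/=] : gcdp f g %| f /\ gcdp f g %| g by rewrite dvdp_gcdl dvdp_gcdr.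
set d := gcdp f g in szg *.
rewrite !Pdiv.Idomain.dvdp_eq; set k1 := lead_coef _ ^+ _; set k2 := lead_coef _ ^+ _.
rewrite -!mul_polyC => /eqP e1 /eqP e2.
have d0 : d != 0 by rewrite -size_poly_gt0 (leq_trans _ szg).
have lc0 k : lead_coef d ^+ k != 0 by rewrite expf_neq0 // lead_coef_eq0.
have [c1 [c2 [q' [d' [c10 c20 _ dE fE]]]]] := polyC_mul_factor (lc0 _) e1.
have /unitrP[q3 [q3q _]] : q' \is a GRing.unit.
  case: (irr _ _ fE) => // /unit_size szd'.
  by move: szg; rewrite dE szc // szd'.
have : k2%:P * g = (g %/ d * c2%:P * q3) * f.
  rewrite e2 {2}dE fE; transitivity (g %/ d * (c2%:P * ((q3 * q') * d'))); last by ring.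
  by rewrite q3q mul1r.
case/(polyC_mul_factor (lc0 _)) => a1 [a2 [q4 [d4 [a10 a20 _ fE4 ->]]]].
have /unitrP[c3 [c32 _]] : a2%:P \is a GRing.unit.
  by apply: (constU _ _ _ fE4); rewrite fE4 szc.
by exists (q4 * c3); rewrite fE4 -[RHS]mulrA [c3 * _]mulrA c32 mul1r.
Qed.
End BivariatePrime.

(** * Irreducible polynomials in two variables are prime *)

Section MultivariatePrime.
Variable C : closedFieldType.
Implicit Types (f g h u v : {mpoly C[2]}).

Definition to_poly2 : {mpoly C[2]} -> {poly {poly C}} :=
  mmap (polyC \o polyC) (fun i => if i == ord0 then 'X%:P else 'X).

HB.instance Definition _ := GRing.RMorphism.on to_poly2.

Definition of_poly1 : {poly C} -> {mpoly C[2]} :=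
  horner_eval 'X_ord0 \o map_poly (@mpolyC 2 C).

HB.instance Definition _ := GRing.RMorphism.on of_poly1.

Definition of_poly2 : {poly {poly C}} -> {mpoly C[2]} :=
  horner_eval 'X_ord_max \o map_poly of_poly1.

HB.instance Definition _ := GRing.RMorphism.on of_poly2.

Lemma ord2P (i : 'I_2) : i = ord0 \/ i = ord_max.
Proof. by case: i => -[|[|//]] ?; [left|right]; apply: val_inj. Qed.

Lemma of_poly1C c : of_poly1 c%:P = c%:MP.
Proof. by rewrite /of_poly1 /= map_polyC horner_evalE hornerC. Qed.

Lemma of_poly1X : of_poly1 'X = 'X_ord0.
Proof. by rewrite /of_poly1 /= map_polyX horner_evalE hornerX. Qed.

Lemma of_poly2C c : of_poly2 c%:P = of_poly1 c.
Proof. by rewrite /of_poly2 /= map_polyC horner_evalE hornerC. Qed.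

Lemma of_poly2X : of_poly2 'X = 'X_ord_max.
Proof. by rewrite /of_poly2 /= map_polyX horner_evalE hornerX. Qed.

Lemma to_poly2C c : to_poly2 c%:MP = c%:P%:P.
Proof. by rewrite /to_poly2 mmapC. Qed.

Lemma to_poly2X i : to_poly2 'X_i = if i == ord0 then 'X%:P else 'X.
Proof. by rewrite /to_poly2 mmapX mmap1U. Qed.

Lemma to_poly2K : cancel to_poly2 of_poly2.
Proof.
move=> p; rewrite [in RHS](mpolyE p) /to_poly2 /mmap (rmorph_sum of_poly2) /=.
apply: eq_bigr => m _; rewrite rmorphM /= of_poly2C of_poly1C mul_mpolyC.
congr (_ *: _); rewrite mpolyXE_id rmorph_prod.
apply: eq_bigr => i _; rewrite rmorphXn /=; congr (_ ^+ _).
by case: (ord2P i) => ->; rewrite /= ?of_poly2C ?of_poly1X ?of_poly2X.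
Qed.

Lemma of_poly2K : cancel of_poly2 to_poly2.
Proof.
have E1 (c : {poly C}) : to_poly2 (of_poly1 c) = c%:P.
  elim/poly_ind: c => [|c a IH]; first by rewrite !rmorph0.
  rewrite !rmorphD !rmorphM /= IH of_poly1C of_poly1X to_poly2C to_poly2X.
  by rewrite eqxx.
elim/poly_ind => [|p c IH]; first by rewrite !rmorph0.
by rewrite !rmorphD !rmorphM /= IH of_poly2C of_poly2X E1 to_poly2X.
Qed.

Lemma nonconstant_nonunit f : nonconstant f -> f \isn't a GRing.unit.
Proof.
rewrite /nonconstant; apply: contraL => /andP[/eqP -> _].
by rewrite -leqNgt msizeC leq_b1.
Qed.

Lemma nonconstant_neq0 f : nonconstant f -> f != 0.
Proof. by rewrite /nonconstant; apply: contraTneq => ->; rewrite msize0. Qed.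

Lemma mirreducible_prime f g h v : mirreducible f -> g * h = v * f ->
  (exists r, g = r * f) \/ (exists r, h = r * f).
Proof.
move=> [ncf irr] e.
have : to_poly2 g * to_poly2 h = to_poly2 v * to_poly2 f by rewrite -!rmorphM e.
case/irreducible_prime_poly2.
- by rewrite -(rmorph0 to_poly2) (can_eq to_poly2K) nonconstant_neq0.
- apply: contra (nonconstant_nonunit ncf) => /(rmorph_unit of_poly2) /=.
  by rewrite to_poly2K.
- move=> q d e'; have /irr : f = of_poly2 q * of_poly2 d.
    by rewrite -[f]to_poly2K e' rmorphM.
  by case=> /(rmorph_unit to_poly2) /=; rewrite of_poly2K; [left|right].
- by case=> r er; left; exists (of_poly2 r);
    rewrite -[g]to_poly2K er rmorphM /= to_poly2K.
- by case=> r er; right; exists (of_poly2 r);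
    rewrite -[h]to_poly2K er rmorphM /= to_poly2K.
Qed.

Lemma msizeM_nz f g : f != 0 -> g != 0 -> (msize (f * g)).+1 = (msize f + msize g)%N.
Proof.
move=> f0 g0; rewrite msizeM // prednK // addn_gt0 lt0n msize_poly_eq0.
by rewrite f0.
Qed.

Lemma size_nonunit f : f != 0 -> f \isn't a GRing.unit -> nonconstant f.
Proof.
move=> f0; apply: contraR; rewrite /nonconstant -leqNgt => /msize1_polyC fE.
rewrite fE in f0 *; rewrite mpolyC_eq0 in f0.
by rewrite rmorph_unit // unitfE.
Qed.

Lemma irreducible_factor f : nonconstant f ->
  exists p g, mirreducible p /\ f = p * g.
Proof.
have [n] := ubnP (msize f); elim: n f => // n IH f szf ncf.
have [irr|] := pselect (mirreducible f).
  by exists f, 1; rewrite mulr1.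
move=> /not_andP[//|] /existsNP[g /existsNP[h /not_implyP[fE /not_orP[/negP gU /negP hU]]]].
have /[!fE] := nonconstant_neq0 ncf; rewrite mulf_eq0 negb_or => /andP[g0 h0].
have ncg := size_nonunit g0 gU; have nch := size_nonunit h0 hU.
have [||p [q [irp gE]]] := IH g => //.
  have := msizeM_nz g0 h0; rewrite -fE; move: nch szf; rewrite /nonconstant; lia.
by exists p, (q * h); rewrite mulrA -gE.
Qed.

(** Coprimality, in terms of syzygies: this is the form in which it determines
    the dimensions of the graded parts of the ideal [(f, g)]. *)
Definition coprime_poly f g : Prop := f != 0 /\
  forall u v, u * f = v * g -> exists2 r, u = r * g & v = r * f.

Lemma mirreducible_coprime f g : mirreducible f -> ~ (exists r, g = r * f) ->
  coprime_poly f g.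
Proof.
move=> irr ndvd; have f0 := nonconstant_neq0 irr.1; split=> // u v e.
have [|//|[r vE]] := @mirreducible_prime f g v u irr; first by rewrite mulrC e.
exists r => //; apply: (mulIf f0); rewrite e vE; ring.
Qed.

(** By induction on the degree of [f]: an irreducible factor of [f] divides
    [v g] but not [g], hence it divides [v] and can be cancelled. *)
Lemma no_common_factor_coprime f g : f != 0 -> no_common_factor f g ->
  coprime_poly f g.
Proof.
have [n] := ubnP (msize f); elim: n f g => // n IH f g szf f0 ncf.
split=> // u v e.
have [/irreducible_factor[p [f' [irp fE]]]|cst] := boolP (nonconstant f).
  have p0 := nonconstant_neq0 irp.1.
  have f'0 : f' != 0 by apply: contraNneq f0 => f'0; rewrite fE f'0 mulr0.
  have [r vE] : exists r, v = r * p.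
    have [||[r gE]] := @mirreducible_prime p v g (u * f') irp => //.
      by rewrite -e fE; ring.
    have /negP[] : ~~ nonconstant p by apply: (ncf p f' r); rewrite // gE mulrC.
    exact: irp.1.
  have szf' : (msize f' < n)%N.
    have := msizeM_nz p0 f'0; rewrite -fE; have := irp.1; rewrite /nonconstant.
    move: szf; lia.
  have ncf' : no_common_factor f' g.
    by move=> q a b f'E gE; apply: (ncf q (p * a) b); rewrite // fE f'E; ring.
  have [_ /(_ u r)[|w uE rE]] := IH f' g szf' f'0 ncf'.
    by apply: (mulfI p0); rewrite mulrCA -fE e vE; ring.
  by exists w; rewrite // vE rE fE; ring.
have fE : f = (f@_0)%:MP by apply: msize1_polyC; rewrite leqNgt.
have fU : f \is a GRing.unit.
  move: f0; rewrite fE mpolyC_eq0 => f0; by rewrite rmorph_unit ?unitfE.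
exists (v * f^-1); last by rewrite divrK.
by apply: (mulIr fU); rewrite e mulrAC divrK.
Qed.
End MultivariatePrime.

(** * Affine charts and homogenization *)

Section Charts.
Variable C : closedFieldType.
Implicit Types (i : 'I_3) (f p q : {mpoly C[2]}) (F G w : {mpoly C[3]}).

Lemma dehomogenize_is_linear i : linear (@dehomogenize C i).
Proof. by move=> c F G; rewrite /dehomogenize linearP. Qed.

Lemma dehomogenize_is_multiplicative i : multiplicative (@dehomogenize C i).
Proof.
by split=> [F G|]; rewrite /dehomogenize ?rmorphM ?rmorph1.
Qed.

HB.instance Definition _ i := GRing.isLinear.Build C {mpoly C[3]} {mpoly C[2]}
  *:%R (@dehomogenize C i) (dehomogenize_is_linear i).
HB.instance Definition _ i := GRing.isMultiplicative.Build
  {mpoly C[3]} {mpoly C[2]} (@dehomogenize C i) (dehomogenize_is_multiplicative i).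

Definition chart_mnm i (m : 'X_{1..3}) : 'X_{1..2} :=
  [multinom m (lift i k) | k < 2].

(** The truncated subtraction is harmless: [d] will bound the degree of [m]. *)
Definition homog_mnm i d (m : 'X_{1..2}) : 'X_{1..3} :=
  [multinom if unlift i j is Some k then m k else (d - mdeg m)%N | j < 3].

Lemma dehomogenizeX i m : dehomogenize i 'X_[m] = 'X_[C, chart_mnm i m].
Proof.
rewrite /dehomogenize comp_mpolyX (bigD1_ord i) //= tnth_mktuple unlift_none.
rewrite expr1n mul1r mpolyXE_id; apply: eq_bigr => k _.
by rewrite tnth_mktuple liftK mnmE.
Qed.

Lemma mdeg_chart i m : mdeg m = (m i + mdeg (chart_mnm i m))%N.
Proof.
rewrite !mdegE (bigD1_ord i) //=; congr addn.
by apply: eq_bigr => k _; rewrite mnmE.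
Qed.

Lemma chart_mnm_inj i m m' : mdeg m = mdeg m' ->
  chart_mnm i m = chart_mnm i m' -> m = m'.
Proof.
move=> em ec; apply/mnmP => j; case: (unliftP i j) => [k|] ->.
  by have /mnmP/(_ k) := ec; rewrite !mnmE.
by move: em; rewrite !(mdeg_chart i) ec => /addIn.
Qed.

Lemma homog_mnmK i d : cancel (homog_mnm i d) (chart_mnm i).
Proof. by move=> m; apply/mnmP => k; rewrite !mnmE liftK. Qed.

Lemma mdeg_homog_mnm i d m : (mdeg m <= d)%N -> mdeg (homog_mnm i d m) = d.
Proof.
by move=> le; rewrite (mdeg_chart i) homog_mnmK mnmE unlift_none subnK.
Qed.

Definition homogen i d f : {mpoly C[3]} :=
  \sum_(m <- msupp f) f@_m *: 'X_[homog_mnm i d m].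

Lemma homogenK i d : cancel (homogen i d) (dehomogenize i).
Proof.
move=> f; rewrite [RHS]mpolyE (raddf_sum (dehomogenize i)) /=.
by apply: eq_bigr => m _; rewrite linearZ /= dehomogenizeX homog_mnmK.
Qed.

Lemma homogen_homog i d f : (msize f <= d.+1)%N -> homogen i d f \is d.-homog.
Proof.
move=> sz; rewrite /homogen big_seq rpred_sum // => m mf; apply: rpredZ.
rewrite dhomogX /= mdeg_homog_mnm //.
by rewrite -ltnS (leq_trans (msize_mdeg_lt mf)).
Qed.

(** In a fixed degree, a monomial is determined by the exponents of the two
    affine variables; a form is thus determined by its restriction to a chart. *)
Lemma mcoeff_dehomogenize i d w m : w \is d.-homog -> mdeg m = d ->
  (dehomogenize i w)@_(chart_mnm i m) = w@_m.
Proof.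
move=> /dhomogP hw dm; rewrite [w in LHS]mpolyE [w in RHS]mpolyE.
rewrite (raddf_sum (dehomogenize i)) !raddf_sum /=.
rewrite [LHS]big_seq [RHS]big_seq; apply: eq_bigr => m' m'w.
rewrite [dehomogenize i _]linearZ /= dehomogenizeX !mcoeffZ !mcoeffX.
congr (_ * _%:R); congr nat_of_bool; apply/eqP/eqP => [|-> //].
by apply: chart_mnm_inj; rewrite dm hw.
Qed.

Lemma dehomogenize_eq0 i d w : w \is d.-homog -> dehomogenize i w = 0 -> w = 0.
Proof.
move=> hw w0; apply/mpolyP => m; rewrite mcoeff0.
have [dm|dm] := eqVneq (mdeg m) d; last exact: dhomog_nemf_coeff hw dm.
by rewrite -(mcoeff_dehomogenize i hw dm) w0 mcoeff0.
Qed.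

Lemma dehomogenize_inj i d w w' : w \is d.-homog -> w' \is d.-homog ->
  dehomogenize i w = dehomogenize i w' -> w = w'.
Proof.
move=> hw hw' e; apply/eqP; rewrite -subr_eq0; apply/eqP.
apply: (@dehomogenize_eq0 i d); first exact: rpredB.
by rewrite rmorphB /= e subrr.
Qed.

Lemma msize_dehomogenize i d w : w \is d.-homog ->
  (msize (dehomogenize i w) <= d.+1)%N.
Proof.
move=> /dhomogP hw; rewrite [w]mpolyE (raddf_sum (dehomogenize i)) /=.
apply: (leq_trans (msize_sum _ _ _)); apply/bigmax_leqP_seq => m mw _.
rewrite linearZ /= dehomogenizeX (leq_trans (msizeZ_le _ _)) //.
rewrite msizeX ltnS -(hw _ mw); by rewrite [leqRHS](mdeg_chart i) leq_addl.
Qed.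

Lemma mevalZ_homog d w (c : C) (v v' : 'I_3 -> C) : w \is d.-homog ->
  (forall j, v' j = c * v j) -> w.@[v'] = c ^+ d * w.@[v].
Proof.
move=> /dhomogP hw e; rewrite !mevalE mulr_sumr big_seq [RHS]big_seq.
apply: eq_bigr => m mw; rewrite mulrCA; congr (_ * _).
have /= <- := hw _ mw; rewrite mdegE -prodrXr -big_split /=.
by apply: eq_bigr => j _; rewrite e exprMn.
Qed.

Lemma meval_chart i d w (X : 'I_3 -> C) : w \is d.-homog -> X i != 0 ->
  w.@[X] = X i ^+ d * (dehomogenize i w).@[chart i X].
Proof.
move=> hw Xi; rewrite /dehomogenize comp_mpoly_meval.
apply: mevalZ_homog hw _ => j; rewrite tnth_mktuple.
case: (unliftP i j) => [k|] ->; rewrite ?mevalXU ?meval1 ?mulr1 //.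
by rewrite /chart mulrC divfK.
Qed.

Lemma homogen_eval i d f X : (msize f <= d.+1)%N -> X i != 0 ->
  (homogen i d f).@[X] = X i ^+ d * f.@[chart i X].
Proof. by move=> sz Xi; rewrite (meval_chart (homogen_homog i sz) Xi) homogenK. Qed.

Lemma dehomogenize_var i : dehomogenize i 'X_i = 1 :> {mpoly C[2]}.
Proof.
rewrite dehomogenizeX -[RHS]mpolyX0; congr 'X_[_]; apply/mnmP=> k.
by rewrite !mnmE (negbTE (neq_lift _ _)).
Qed.

(** Exactness of the Koszul complex of two forms of degrees [a] and [b] in the
    middle, in all degrees: every syzygy [u F = v G] is a multiple of the
    trivial one, [(u, v) = (G, F)]. *)
Definition koszul_exact a b F G : Prop := forall k u v,
  u \is (k + b).-homog -> v \is (k + a).-homog -> u * F = v * G ->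
  exists w, [/\ w \is k.-homog, u = w * G & v = w * F].

(** As the restriction of [F] to the chart keeps its degree [a], the cofactor
    [r] of the affine syzygy has degree at most [k], hence it homogenizes to a
    form of degree [k]. *)
Lemma coprime_koszul i a b F G : F \is (a).-homog -> G \is b.-homog ->
  msize (dehomogenize i F) = a.+1 ->
  coprime_poly (dehomogenize i F) (dehomogenize i G) -> koszul_exact a b F G.
Proof.
move=> hF hG szF [F0 cop] k u v hu hv e.
have [r ur vr] : exists2 r, dehomogenize i u = r * dehomogenize i G
  & dehomogenize i v = r * dehomogenize i F by apply: cop; rewrite -!rmorphM e.
have szr : (msize r <= k.+1)%N.
  have [->|r0] := eqVneq r 0; first by rewrite msize0.
  have := msizeM_nz r0 F0; rewrite -vr szF.
  have := msize_dehomogenize i hv; lia.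
exists (homogen i k r); split; first exact: homogen_homog.
  apply: (dehomogenize_inj (i := i) hu); first exact: dhomogM (homogen_homog _ _) hG.
  by rewrite rmorphM /= homogenK.
apply: (dehomogenize_inj (i := i) hv); first exact: dhomogM (homogen_homog _ _) hF.
by rewrite rmorphM /= homogenK.
Qed.

End Charts.

(** * Hilbert functions of plane complete intersections *)

Section HomogeneousComponents.
Variables (n : nat) (C : closedFieldType).
Implicit Types (F u : {mpoly C[n]}).

Lemma pihomogM_sum a D u F : F \is (a).-homog ->
  pihomog mdeg D (u * F) =
    \sum_(e < msize u | (e + a == D)%N) pihomog mdeg e u * F.
Proof.
move=> hF; have := @pihomog_partitionE _ _ mdeg _ u (leqnn _).
move=> {1}->; rewrite mulr_suml raddf_sum /= [RHS]big_mkcond /=.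
apply: eq_bigr => e _.
have he : pihomog mdeg e u * F \is (e + a).-homog.
  exact: dhomogM (pihomogP _ _ _) hF.
case: eqP => [<-|/eqP ne]; first by rewrite pihomog_dE.
by rewrite (pihomog_ne0 ne he).
Qed.

Lemma pihomogM a d u F : F \is (a).-homog ->
  pihomog mdeg (d + a) (u * F) = pihomog mdeg d u * F.
Proof.
move=> hF; rewrite (pihomogM_sum _ _ hF).
rewrite (eq_bigl (fun e : 'I__ => e == d :> nat)); last first.
  by move=> e; rewrite eqn_add2r.
have [ltd|led] := ltnP d (msize u).
  by rewrite (big_pred1 (Ordinal ltd)) // => e; rewrite -val_eqE.
rewrite big_pred0 => [|e]; last by apply/eqP => ed; move: (ltn_ord e); lia.
rewrite pihomogE big_seq_cond big_pred0 ?mul0r // => m.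
by apply/andP => -[/msize_mdeg_lt mu /eqP md]; move: mu md; rewrite /=; lia.
Qed.

Lemma pihomogM_lt a D u F : F \is (a).-homog -> (D < a)%N ->
  pihomog mdeg D (u * F) = 0.
Proof.
move=> hF lt; rewrite (pihomogM_sum _ _ hF) big_pred0 // => e.
by apply/eqP; lia.
Qed.

End HomogeneousComponents.

Section HilbertFunction.
Variable C : closedFieldType.
Implicit Types (F G p u v w : {mpoly C[3]}).
Local Notation S d := (dhomog 3 C d).

Lemma dim_dhomog d : \dim {: S d} = 'C(d + 2, 2).
Proof. by rewrite dimvf -bin_sub ?leq_addl // addnK. Qed.

Lemma double_dim_dhomog d : (\dim {: S d} * 2 = (d + 2) * (d + 1))%N.
Proof. by rewrite dim_dhomog addn2 addn1 muln2 bin2 -mul2n; elim: d => // d; lia. Qed.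

Definition proj d p : S d := DHomog (pihomogP mdeg d p).

Arguments proj : simpl never.

Lemma proj_is_linear d : linear (proj d).
Proof. by move=> c p q; apply: val_inj; rewrite /= linearP. Qed.

HB.instance Definition _ d :=
  GRing.isLinear.Build C {mpoly C[3]} (S d) *:%R (proj d) (proj_is_linear d).

Lemma val_proj d p : p \is d.-homog -> mpoly_of_dhomog (proj d p) = p.
Proof. exact: pihomog_dE. Qed.

(** Membership is not required to respect degrees; [in_ideal_pihomog] recovers
    homogeneous coefficients. *)
Definition in_ideal F G p : Prop := exists u v, p = u * F + v * G.

Lemma in_idealD F G p q : in_ideal F G p -> in_ideal F G q -> in_ideal F G (p + q).
Proof. by move=> [u [v ->]] [u' [v' ->]]; exists (u + u'), (v + v'); ring. Qed.

Lemma in_idealM F G p q : in_ideal F G p -> in_ideal F G (q * p).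
Proof. by move=> [u [v ->]]; exists (q * u), (q * v); ring. Qed.

Lemma in_ideal0 F G : in_ideal F G 0.
Proof. by exists 0, 0; ring. Qed.

Lemma in_ideal_gen1 F G : in_ideal F G F.
Proof. by exists 1, 0; ring. Qed.

Lemma in_ideal_gen2 F G : in_ideal F G G.
Proof. by exists 0, 1; ring. Qed.

Lemma in_ideal_pihomog a b F G p D : F \is (a).-homog -> G \is b.-homog ->
  in_ideal F G p -> in_ideal F G (pihomog mdeg D p).
Proof.
move=> hF hG [u [v ->]]; rewrite raddfD /=.
have aux c u' H : H \is c.-homog -> exists w, pihomog mdeg D (u' * H) = w * H.
  move=> hH; have [lt|le] := ltnP D c.
    by exists 0; rewrite (pihomogM_lt _ hH) // mul0r.
  by exists (pihomog mdeg (D - c) u'); rewrite -(pihomogM _ _ hH) subnK.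
by have [w ->] := aux _ u _ hF; have [w' ->] := aux _ v _ hG; exists w, w'.
Qed.

Section DegreePart.
Variables (a b k : nat) (F G : {mpoly C[3]}).
Hypotheses (hF : F \is (a).-homog) (hG : G \is b.-homog).

(** The two maps [S_k -> S_(k+b) x S_(k+a) -> S_(k+a+b)] of the Koszul complex
    are [syzygy] and [combination]; the image of the latter is [(F, G)_(k+a+b)]. *)
Definition combination (uv : S (k + b) * S (k + a)) : S (k + a + b) :=
  proj (k + a + b) (mpoly_of_dhomog uv.1 * F + mpoly_of_dhomog uv.2 * G).

Arguments combination : simpl never.

Lemma combination_is_linear : linear combination.
Proof.
move=> c [u v] [u' v']; rewrite /combination -linearP; congr proj.
by rewrite /= !mulrDl -!scalerAl scalerDr; ring.
Qed.

HB.instance Definition _ := GRing.isLinear.Build C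
  (S (k + b) * S (k + a))%type (S (k + a + b)) *:%R combination
  combination_is_linear.

Lemma combinationE uv : linfun combination uv = combination uv.
Proof. by rewrite lfunE. Qed.

Definition ideal_part : {vspace S (k + a + b)} := limg (linfun combination).

Lemma val_combination uv : mpoly_of_dhomog (combination uv) =
  mpoly_of_dhomog uv.1 * F + mpoly_of_dhomog uv.2 * G.
Proof.
rewrite /combination val_proj //; apply: rpredD.
  by rewrite addnAC; apply: dhomogM (dhomog_is_dhomog _) hF.
exact: dhomogM (dhomog_is_dhomog _) hG.
Qed.

Lemma ideal_partP (p : S (k + a + b)) : p \in ideal_part <-> in_ideal F G (mpoly_of_dhomog p).
Proof.
split=> [/memv_imgP[uv _ ->]|[u [v e]]].
  by rewrite combinationE val_combination; exists (mpoly_of_dhomog uv.1), (mpoly_of_dhomog uv.2).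
apply/memv_imgP; exists (proj (k + b) u, proj (k + a) v); first exact: memvf.
rewrite combinationE; apply: val_inj; rewrite [RHS]val_combination /=.
rewrite -(pihomogM _ _ hF) -(pihomogM _ _ hG) [(k + b + a)%N]addnAC -raddfD -e /=.
exact/esym/pihomog_dE/dhomog_is_dhomog.
Qed.

Definition syzygy (w : S k) : S (k + b) * S (k + a) :=
  (proj (k + b) (mpoly_of_dhomog w * G), proj (k + a) (- (mpoly_of_dhomog w * F))).

Arguments syzygy : simpl never.

Lemma syzygy_is_linear : linear syzygy.
Proof.
move=> c w w'; rewrite /syzygy -[RHS]/(_, _) /= -!linearP.
by congr (proj _ _, proj _ _);
  rewrite /= !mulrDl -!scalerAl ?scalerN ?opprD.
Qed.

HB.instance Definition _ := GRing.isLinear.Build C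
  (S k) (S (k + b) * S (k + a))%type *:%R syzygy syzygy_is_linear.

Lemma syzygyE (w : S k) : linfun syzygy w = syzygy w.
Proof. by rewrite lfunE. Qed.

Lemma val_syzygy (w : S k) : (mpoly_of_dhomog (syzygy w).1 = mpoly_of_dhomog w * G) *
  (mpoly_of_dhomog (syzygy w).2 = - (mpoly_of_dhomog w * F)).
Proof.
split; rewrite val_proj ?rpredN //.
  exact: dhomogM (dhomog_is_dhomog _) hG.
exact: dhomogM (dhomog_is_dhomog _) hF.
Qed.

Lemma syzygy_ker : (limg (linfun syzygy) <= lker (linfun combination))%VS.
Proof.
apply/subvP => _ /memv_imgP[w _ ->]; rewrite memv_ker syzygyE combinationE.
by apply/eqP/val_inj; rewrite [LHS]val_combination !val_syzygy /=; ring.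
Qed.

Lemma dim_syzygy : F != 0 -> \dim (limg (linfun syzygy)) = \dim {: S k}.
Proof.
move=> F0; have := limg_ker_dim (linfun syzygy) fullv.
rewrite capfv (_ : lker _ = 0%VS) ?dimv0 //.
apply/eqP; rewrite -subv0; apply/subvP => w; rewrite memv_ker syzygyE => /eqP e.
have := congr1 (fun x => mpoly_of_dhomog x.2) e; rewrite val_syzygy /= => /eqP.
rewrite oppr_eq0 mulf_eq0 (negbTE F0) orbF => /eqP w0.
by rewrite memv0; apply/eqP/val_inj.
Qed.

Lemma dim_combination : (\dim ideal_part + \dim (lker (linfun combination)) =
  \dim {: S (k + b)} + \dim {: S (k + a)})%N.
Proof.
have := limg_ker_dim (linfun combination) fullv; rewrite capfv => e.
by rewrite addnC /ideal_part e !dimvf.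
Qed.

(** The alternating sum of the dimensions in the Koszul complex: the mixed second
    difference, with steps [a] and [b], of the quadratic polynomial
    [(d + 2) (d + 1) / 2]. *)
Lemma dim_count : (\dim {: S (k + a + b)} + \dim {: S k} =
  \dim {: S (k + b)} + \dim {: S (k + a)} + a * b)%N.
Proof.
have := double_dim_dhomog (k + a + b); have := double_dim_dhomog k.
have := double_dim_dhomog (k + a); have := double_dim_dhomog (k + b).
nia.
Qed.

(** Each trivial syzygy lowers the rank of [combination] by one. *)
Lemma dim_ideal_part_le : F != 0 -> (\dim ideal_part + a * b <= \dim {: S (k + a + b)})%N.
Proof.
move=> F0; have := dimvS syzygy_ker; rewrite dim_syzygy //.
have := dim_combination; have := dim_count; lia.
Qed.

(** Exactness turns the previous bound into an equality, for there are no other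
    syzygies. *)
Lemma dim_ideal_part : F != 0 -> koszul_exact a b F G ->
  (\dim ideal_part + a * b = \dim {: S (k + a + b)})%N.
Proof.
move=> F0 kos; have := dim_combination; have := dim_count.
suff <- : limg (linfun syzygy) = lker (linfun combination).
  by rewrite dim_syzygy //; lia.
apply/eqP; rewrite eqEsubv syzygy_ker /=; apply/subvP => -[u v].
rewrite memv_ker combinationE => /eqP/(congr1 (@mpoly_of_dhomog _ _ _)).
rewrite val_combination /= => /eqP.
rewrite addr_eq0 -mulNr => /eqP e.
have [||w [hw uE vE]] := kos k _ _ _ _ e; rewrite ?rpredN; try exact: dhomog_is_dhomog.
apply/memv_imgP; exists (DHomog hw); first exact: memvf.
rewrite syzygyE; congr pair; apply: val_inj; rewrite [RHS]val_proj /= ?rpredN //.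
- exact: dhomogM hw hG.
- by rewrite -vE opprK.
- exact: dhomogM hw hF.
Qed.

End DegreePart.
End HilbertFunction.

(** * The Nullstellensatz in finite codimension *)

Section LinearAlgebra.
Variables (K : fieldType) (U V : vectType K).

Lemma preimage_nontrivial (f : 'Hom(U, V)) (W : {vspace V}) :
  (\dim {:V} < \dim {:U} + \dim W)%N -> exists2 u, u != 0 & f u \in W.
Proof.
move=> lt; have [ker0|kerN0] := eqVneq (lker f) 0%VS; last first.
  exists (vpick (lker f)); first by rewrite vpick0.
  by have := memv_pick (lker f); rewrite memv_ker => /eqP ->; rewrite mem0v.
have := limg_ker_dim f fullv; rewrite ker0 capv0 dimv0 add0n => dimf.
have capN0 : (limg f :&: W)%VS != 0%VS.
  rewrite -dimv_eq0 -lt0n; have := dimv_sum_cap (limg f) W.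
  have := dimvS (subvf (limg f + W)%VS); lia.
have /memv_capP[/memv_imgP[u _ uE] inW] := memv_pick (limg f :&: W)%VS.
exists u; last by rewrite -uE.
by apply: contraNneq capN0 => u0; rewrite -vpick0 uE u0 linear0.
Qed.

End LinearAlgebra.

Section Nullstellensatz.
Variables (n : nat) (C : closedFieldType).
Implicit Types (I J : {mpoly C[n]} -> Prop) (p q r l : {mpoly C[n]}).

Definition is_ideal I : Prop :=
  [/\ I 0, forall p q, I p -> I q -> I (p + q) & forall p q, I p -> I (q * p)].

Definition add_gen I l p : Prop := exists q r, I q /\ p = q + r * l.

Lemma is_ideal_add_gen I l : is_ideal I -> is_ideal (add_gen I l).
Proof.
move=> [I0 ID IM]; split.
- by exists 0, 0; split=> //; ring.
- move=> _ _ [q [r [Iq ->]]] [q' [r' [Iq' ->]]].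
  by exists (q + q'), (r + r'); split; [exact: ID|ring].
- move=> _ p [q [r [Iq ->]]].
  by exists (p * q), (p * r); split; [exact: IM|ring].
Qed.

Lemma add_gen_sub I l p : I p -> add_gen I l p.
Proof. by exists p, 0; split=> //; ring. Qed.

Lemma add_gen_gen I l : is_ideal I -> add_gen I l l.
Proof. by case=> I0 _ _; exists 0, 1; split=> //; ring. Qed.

Definition poly_at (c : {poly C}) l : {mpoly C[n]} := (map_poly (@mpolyC n C) c).[l].

(** In the quotient, [c(l)] vanishes, thus some [l - a] is not invertible
    unless the quotient is trivial. *)
Lemma ideal_root_split I l (c : {poly C}) : is_ideal I -> c != 0 ->
  I (poly_at c l) -> (forall x, add_gen I (l - x%:MP) 1) -> I 1.
Proof.
move=> [I0 ID IM] c0 Ic inv; move: c c0 Ic; apply: poly_root_ind => [x x0|c x c0 IH].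
  rewrite /poly_at map_polyC hornerC => Ix; rewrite -mpolyC1 -(mulVf x0) mpolyCM.
  exact: IM.
rewrite /poly_at rmorphM hornerM rmorphB /= map_polyX map_polyC hornerXsubC.
rewrite -/(poly_at c l) => Icx; apply: IH.
have [q [r [Iq e]]] := inv x.
rewrite -[poly_at c l]mulr1 e mulrDr mulrA [_ * r]mulrC -mulrA.
by apply: ID; apply: IM.
Qed.

(** Hilbert's Nullstellensatz when each variable satisfies a polynomial equation
    modulo [I]: adjoin the [X_i - x_i] one after the other, the value [x_i] being
    a root of [c i] for which the ideal remains proper. The resulting proper ideal
    is the one of the point [x]. *)
Lemma ideal_has_zero I (c : 'I_n -> {poly C}) : is_ideal I ->
  (forall i, c i != 0 /\ I (poly_at (c i) 'X_i)) -> ~ I 1 ->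
  exists X : 'I_n -> C, forall p, I p -> p.@[X] = 0.
Proof.
move=> idI cI I1.
have [X [J [[J0 JD JM] IJ J1 JX]]] : exists (X : 'I_n -> C) J,
    [/\ is_ideal J, forall p, I p -> J p, ~ J 1
      & forall i, i \in enum 'I_n -> J ('X_i - (X i)%:MP)].
  elim: (enum 'I_n) => [|i s [X [J [idJ IJ J1 JX]]]].
    by exists (fun=> 0), I; split.
  have [x Jx1] : exists x, ~ add_gen J ('X_i - x%:MP) 1.
    apply/existsNP => inv; apply: J1.
    exact: (ideal_root_split idJ (cI i).1 (IJ _ (cI i).2) inv).
  have [/JX JXi|nis] := boolP (i \in s).
    exists X, J; split=> // j; rewrite inE => /orP[/eqP -> //|/JX //].
  exists (fun j => if j == i then x else X j), (add_gen J ('X_i - x%:MP)); split=> //.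
  - exact: is_ideal_add_gen.
  - by move=> p /IJ; apply: add_gen_sub.
  - move=> j; rewrite inE; case: eqVneq => [-> _|_ /JX]; last exact: add_gen_sub.
    exact: add_gen_gen.
have JX' i : J ('X_i - (X i)%:MP) by apply: JX; rewrite mem_enum.
have Jcong p : J (p - p.@[X]%:MP).
  rewrite mevalE [X in X - _]mpolyE raddf_sum /= -sumrB.
  elim/big_ind: _ => // m _; rewrite mpolyCM -mul_mpolyC -mulrBr; apply: (JM).
  rewrite mpolyXE_id; apply: (big_ind2 (fun p x => J (p - x%:MP))).
  - by rewrite mpolyC1 subrr.
  - move=> p1 x1 p2 x2 J1' J2'.
    rewrite mpolyCM (_ : _ - _ = p2 * (p1 - x1%:MP) + x1%:MP * (p2 - x2%:MP)); last by ring.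
    by apply: JD; apply: JM.
  - move=> i _; elim: (m i) => [|k IH]; first by rewrite !expr0 mpolyC1 subrr.
    rewrite !exprS mpolyCM (_ : _ - _ = 'X_i * ('X_i ^+ k - (X i ^+ k)%:MP)
      + (X i ^+ k)%:MP * ('X_i - (X i)%:MP)); last by ring.
    by apply: JD; apply: JM.
exists X => p Ip; apply/eqP/negPn/negP => pX; apply: J1.
rewrite -mpolyC1 -(mulVf pX) mpolyCM; apply: (JM).
rewrite (_ : _%:MP = -1 * (p - p.@[X]%:MP) + p); last by ring.
by apply: JD; [apply: JM|apply: IJ].
Qed.

(** Compare the homogeneous components of [s = g + r (l - 1)] modulo [I]: below
    the degree [E] of [s] those of [r] vanish, then the component of degree
    [E + k] is [- l^k s]. It vanishes for large [k] because [r] is a polynomial. *)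
Lemma homogeneous_rabinowitsch I l E s : is_ideal I ->
  (forall p d, I p -> I (pihomog mdeg d p)) -> l \is 1.-homog -> s \is E.-homog ->
  add_gen I (l - 1) s -> exists k, I (l ^+ k * s).
Proof.
move=> [I0 ID IM] Ih hl hs [g [r [Ig sE]]].
have IN p : I p -> I (- p) by rewrite -mulN1r; apply: IM.
have rE : r = r * l + g - s by rewrite sE; ring.
pose rho d := pihomog mdeg d r.
have rho0 : rho 0%N = pihomog mdeg 0 g - pihomog mdeg 0 s.
  by rewrite /rho [in LHS]rE raddfB raddfD /= (pihomogM_lt _ hl) // add0r.
have rhoS d : rho d.+1 = rho d * l + pihomog mdeg d.+1 g - pihomog mdeg d.+1 s.
  rewrite /rho [in LHS]rE raddfB raddfD /=.
  by rewrite -[in X in X + _ - _]addn1 (pihomogM _ _ hl).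
have s0 d : d != E -> pihomog mdeg d s = 0.
  by move=> ne; rewrite (pihomog_ne0 _ hs) // eq_sym.
have low d : (d < E)%N -> I (rho d).
  elim: d => [|d IH] ltE.
    by rewrite rho0 s0 ?subr0 ?(ltn_eqF ltE) //; exact: Ih.
  rewrite rhoS s0 ?subr0 ?(ltn_eqF ltE) //; apply: ID; last exact: Ih.
  by rewrite mulrC; apply: IM; apply: IH; exact: ltnW.
have high k : I (rho (E + k)%N + l ^+ k * s).
  elim: k => [|k IH].
    rewrite addn0 expr0 mul1r; case: (E) low (pihomog_dE hs) => [|e] lowe sE'.
      by rewrite rho0 sE' subrK; exact: Ih.
    rewrite rhoS sE' subrK; apply: ID; last exact: Ih.
    by rewrite mulrC; apply: IM; exact: lowe.
  rewrite addnS rhoS s0; last by lia.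
  rewrite subr0.
  have := ID _ _ (IM _ l IH) (Ih _ (E + k).+1 Ig).
  by congr I; rewrite exprS; ring.
exists (msize r); suff rz : rho (E + msize r)%N = 0.
  by have := high (msize r); rewrite rz add0r.
rewrite /rho pihomogE big_seq_cond big_pred0 // => m.
by apply/andP => -[/msize_mdeg_lt mu /eqP md]; move: mu md; rewrite /=; lia.
Qed.
End Nullstellensatz.

(** * A linear form regular modulo two forms *)

Section PlaneCurves.
Variable C : closedFieldType.
Implicit Types (p q r u v w s t l : {mpoly C[3]}) (X Y : 'I_3 -> C).
Local Notation S d := (dhomog 3 C d).

Variables (a b : nat) (F G : {mpoly C[3]}).
Hypotheses (hF : F \is (a).-homog) (hG : G \is b.-homog).
Hypotheses (F0 : F != 0) (kos : koszul_exact a b F G).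

Lemma is_ideal_in_ideal : is_ideal (in_ideal F G).
Proof.
by split; [exact: in_ideal0|exact: in_idealD|move=> p q; exact: in_idealM].
Qed.

Lemma pow_sub1 t n : exists r, t ^+ n - 1 = r * (t - 1).
Proof. by rewrite subrX1; eexists; rewrite mulrC. Qed.

(** The [D + 1] products [l^i t^(D - i)] are dependent modulo [(F, G)] as soon
    as [D >= a b], because the codimension of [(F, G)] is [a b]. *)
Lemma in_ideal_poly_at l t : l \is 1.-homog -> t \is 1.-homog ->
  exists2 c : {poly C}, c != 0 & add_gen (in_ideal F G) (t - 1) (poly_at c l).
Proof.
move=> hl ht; pose D := (a * b + a + b)%N.
pose f (v : 'rV[C]_D.+1) : S D := proj D (\sum_i v 0 i *: (l ^+ i * t ^+ (D - i))).
have f_lin : linear f.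
  move=> x v v'; rewrite /f -linearP; congr proj; rewrite scaler_sumr -big_split /=.
  by apply: eq_bigr => i _; rewrite !mxE scalerDl scalerA.
pose fl := GRing.isLinear.Build _ _ _ _ f f_lin.
pose F' : {linear 'rV[C]_D.+1 -> S D} := HB.pack f fl.
have [v v0] : exists2 v, v != 0 & linfun F' v \in ideal_part a b (a * b) F G.
  apply: preimage_nontrivial; have := dim_ideal_part (a * b) hF hG F0 kos.
  rewrite -/D => <-.
  have dimrV : \dim {: 'rV[C]_D.+1} = D.+1.
    by rewrite dimvf; exact: mul1n.
  rewrite dimrV addSn ltnS addnC leq_add2r.
  by rewrite /D -addnA leq_addr.
rewrite lfunE /= => /(ideal_partP hF hG) /=; rewrite pihomog_dE => [vI|]; last first.
  apply: rpred_sum => i _; apply: rpredZ.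
  have := dhomogM (dhomogMn i hl) (dhomogMn (D - i) ht).
  by rewrite !mul1n subnKC // -ltnS.
exists (rVpoly v).
  by apply: contraNneq v0 => e; rewrite -[v]rVpolyK e linear0.
have [r rE] : exists r, \sum_i v 0 i *: (l ^+ i * (t ^+ (D - i) - 1)) = r * (t - 1).
  elim/big_ind: _ => [|p q [r ->] [r' ->]|i _].
  - by exists 0; rewrite mul0r.
  - by exists (r + r'); rewrite mulrDl.
  - have [r ->] := pow_sub1 t (D - i); exists (v 0 i *: (l ^+ i * r)).
    by rewrite -scalerAl mulrA.
exists (\sum_i v 0 i *: (l ^+ i * t ^+ (D - i))), (- r); split=> //.
rewrite mulNr -rE -sumrB /poly_at (@horner_coef_wide _ D.+1).
  apply: eq_bigr => i _; rewrite coef_map coef_rVpoly_ord /= mul_mpolyC -scalerBr.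
  by congr (_ *: _); ring.
exact: leq_trans (size_poly _ _) (size_poly _ _).
Qed.

(** On the affine chart [t = 1], every coordinate satisfies a polynomial equation
    modulo [(F, G)], hence the Nullstellensatz applies to [I]. *)
Lemma unit_on_chart (I : {mpoly C[3]} -> Prop) t : is_ideal I ->
  (forall p, in_ideal F G p -> I p) -> t \is 1.-homog ->
  (forall X, (forall p, I p -> p.@[X] = 0) -> t.@[X] != 1) ->
  add_gen I (t - 1) 1.
Proof.
move=> idI sub ht noX; apply: contrapT => J1.
have idJ := is_ideal_add_gen (t - 1) idI.
have cP i : exists c : {poly C}, c != 0 /\ add_gen I (t - 1) (poly_at c 'X_i).
  have hX : 'X_i \is [in C[3], 1.-homog] by rewrite dhomogX /= mdeg1.
  have [c c0 [g [r [Ig e]]]] := in_ideal_poly_at hX ht.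
  by exists c; split=> //; exists g, r; split=> //; apply: sub.
have [X JX] := ideal_has_zero idJ (fun i => projT2 (cid (cP i))) J1.
have [] := noX X (fun p Ip => JX p (add_gen_sub _ Ip)); apply/negP; rewrite negbK.
by have := JX _ (add_gen_gen _ idI); rewrite mevalB meval1 => /subr0_eq ->.
Qed.

(** If [t] vanishes at no common zero, then [S_D = (F, G)_D + t S_(D - 1)] for
    large [D] by the Nullstellensatz; as [S / (F, G)] has the same dimension in
    the degrees [D - 1] and [D], multiplication by [t] is also injective. *)
Lemma linear_form_regular t : t \is 1.-homog -> t != 0 ->
  (forall X, F.@[X] = 0 -> G.@[X] = 0 -> t.@[X] = 0 -> forall i, X i = 0) ->
  exists E0, forall E s, (E0 <= E)%N -> s \is E.-homog ->
    in_ideal F G (t * s) -> in_ideal F G s.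
Proof.
move=> ht t0 noX; pose I := add_gen (in_ideal F G) t.
have idI : is_ideal I := is_ideal_add_gen t is_ideal_in_ideal.
have subI p : in_ideal F G p -> I p by apply: add_gen_sub.
have It : I t := add_gen_gen t is_ideal_in_ideal.
have IX p X : I p -> F.@[X] = 0 -> G.@[X] = 0 -> t.@[X] = 0 -> p.@[X] = 0.
  move=> [q [r [[u [v ->]] ->]]] FX GX tX.
  by rewrite !mevalD !mevalM FX GX tX !mulr0 !addr0.
have Ih p d : I p -> I (pihomog mdeg d p).
  move=> [q [r [Iq ->]]]; rewrite raddfD /=.
  have [_ ID _] := idI; apply: ID; first exact/subI/(in_ideal_pihomog _ hF hG).
  case: d => [|d]; first by rewrite (pihomogM_lt _ ht) //; case: idI.
  by rewrite -[d.+1]addn1 (pihomogM _ _ ht); have [_ _ IM] := idI; apply: IM.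
have powX i : exists k, I ('X_i ^+ k).
  have hX : 'X_i \is [in C[3], 1.-homog] by rewrite dhomogX /= mdeg1.
  have h1 : (1 : {mpoly C[3]}) \is 0.-homog by apply: dhomog1.
  have [|k] := homogeneous_rabinowitsch idI Ih hX h1; last first.
    by rewrite mulr1 => Ik; exists k.
  apply: unit_on_chart => // X IX0.
  have Xi0 : X i = 0.
    apply: noX; apply: IX0 => //; apply: subI; [exact: in_ideal_gen1|exact: in_ideal_gen2].
  by rewrite mevalXU Xi0 eq_sym oner_neq0.
pose N i := projT1 (cid (powX i)); have IN i : I ('X_i ^+ N i) := projT2 (cid (powX i)).
pose N0 := (\sum_i N i)%N.
have IE E s : (N0 <= E)%N -> s \is E.-homog -> I s.
  move=> leE /dhomogP hs; rewrite [s]mpolyE; have [I0 ID IM] := idI.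
  rewrite big_seq; elim/big_ind: _ => // m ms; rewrite -mul_mpolyC; apply: (IM).
  have [i Ni] : exists i, (N i <= m i)%N.
    apply: contrapT => lt; have := leq_trans leE (eq_leq (esym (hs m ms))).
    rewrite /N0 /= mdegE leqNgt => /negP[]; apply: (@leq_trans (\sum_(i < 3) (m i).+1)).
      by rewrite !big_ord_recl big_ord0; lia.
    by apply: leq_sum => i _; rewrite ltnNge; apply/negP => h; apply: lt; exists i.
  rewrite mpolyXE_id (bigD1 i) //= -(subnK Ni) exprD mulrAC; exact: (IM).
exists (N0 + a + b)%N => E s leE hs.
have [k kE] : exists k, E = (k + a + b)%N by exists (E - a - b)%N; lia.
rewrite kE in leE hs; clear E kE => ts.
pose A1 := ideal_part a b k F G; pose A2 := ideal_part a b k.+1 F G.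
pose f (v : S (k + a + b)) : S (k.+1 + a + b) := proj _ (t * mpoly_of_dhomog v).
have f_lin : linear f.
  by move=> x v v'; rewrite /f -linearP; congr proj; rewrite /= mulrDr scalerAr.
have fE (v : S (k + a + b)) : mpoly_of_dhomog (f v) = t * mpoly_of_dhomog v.
  rewrite val_proj // !addSn -[(k + a + b).+1]add1n; exact: dhomogM ht (dhomog_is_dhomog _).
pose fl := GRing.isLinear.Build _ _ _ _ f f_lin.
pose f' : {linear S (k + a + b) -> S (k.+1 + a + b)} := HB.pack f fl.
have f'E (v : S (k + a + b)) : linfun f' v = f v by rewrite lfunE.
have ker0 : lker (linfun f') = 0%VS.
  apply/eqP; rewrite -subv0; apply/subvP => v; rewrite memv_ker f'E memv0.
  move=> /eqP/(congr1 (@mpoly_of_dhomog _ _ _)); rewrite fE /= => /eqP.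
  by rewrite mulf_eq0 (negbTE t0) => /eqP v0; apply/eqP/val_inj.
have sum_full : (limg (linfun f') + A2)%VS = fullv.
  apply/eqP; rewrite eqEsubv subvf /=; apply/subvP => v _.
  have [q [r [qI vE]]] : I (mpoly_of_dhomog v).
    by apply: IE (dhomog_is_dhomog _); lia.
  apply/memv_addP.
  exists (f (proj _ r)); first by rewrite -f'E; apply: memv_img; apply: memvf.
  exists (proj _ q).
    apply/(ideal_partP hF hG) => /=; exact: in_ideal_pihomog hF hG qI.
  have vh : pihomog mdeg (k.+1 + a + b) (mpoly_of_dhomog v) = mpoly_of_dhomog v.
    exact: pihomog_dE (dhomog_is_dhomog v).
  have rt : pihomog mdeg (k.+1 + a + b) (r * t) = pihomog mdeg (k + a + b) r * t.
    by rewrite -(pihomogM _ _ ht) addn1.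
  apply: val_inj; transitivity (t * pihomog mdeg (k + a + b) r
      + pihomog mdeg (k.+1 + a + b) q); last first.
    by rewrite -[pihomog mdeg (k + a + b) r]/(mpoly_of_dhomog (proj (k + a + b) r)) -fE.
  by rewrite [LHS]/= -vh vE raddfD /= rt mulrC addrC.
have dimf : \dim (limg (linfun f')) = \dim {: S (k + a + b)}.
  by have := limg_ker_dim (linfun f') fullv; rewrite ker0 capv0 dimv0 add0n.
have dim1 := dim_ideal_part k hF hG F0 kos.
have dim2 := dim_ideal_part k.+1 hF hG F0 kos.
have := dimv_sum_cap (limg (linfun f')) A2; rewrite sum_full dimf.
have kerB B : \dim (linfun f' @: B) = \dim B.
  by have := limg_ker_dim (linfun f') B; rewrite ker0 capv0 dimv0 add0n.
pose B := (linfun f' @^-1: A2)%VS.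
have fB : (linfun f' @: B)%VS = (A2 :&: limg (linfun f'))%VS.
  by rewrite /B -lpreim_cap_limg lpreimK // capvSr.
rewrite capvC -fB kerB => dimB.
have A1B : (A1 <= B)%VS.
  apply/subvP => v /(ideal_partP hF hG) vI; rewrite -memv_preim f'E.
  by apply/(ideal_partP hF hG); rewrite fE; apply: in_idealM.
have /eqP A1E : A1 == B.
  have arith (d1 d2 d3 s1 s2 c : nat) : (d1 + c = s1 -> d2 + c = s2 ->
      s2 + d3 = s1 + d2 -> d3 <= d1)%N by lia.
  by rewrite eqEdim A1B /=; apply: arith dim1 dim2 dimB.
have : DHomog hs \in A1.
  rewrite A1E -memv_preim f'E; apply/(ideal_partP hF hG); by rewrite fE.
by move/(ideal_partP hF hG).
Qed.

End PlaneCurves.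

(** * Points of the projective plane and the bound of Bezout *)

Section ProjectivePoints.
Variable C : closedFieldType.
Implicit Types (p u v w t : {mpoly C[3]}) (X Y : 'I_3 -> C) (s : seq ('I_3 -> C)).
Local Notation S d := (dhomog 3 C d).

Definition proj_eq X Y := [forall i, forall j, X i * Y j == X j * Y i].

Lemma proj_eqP X Y : reflect (forall i j, X i * Y j = X j * Y i) (proj_eq X Y).
Proof.
apply: (iffP forallP) => [h i j|h i]; first by apply/eqP; move/forallP: (h i).
by apply/forallP => j; apply/eqP.
Qed.

Lemma proj_eq_vanish X Y d p : is_proj_point X -> is_proj_point Y ->
  proj_eq X Y -> p \is d.-homog -> p.@[X] = 0 -> p.@[Y] = 0.
Proof.
move=> [i Xi] _ /proj_eqP XY hp pX.
rewrite (mevalZ_homog (c := Y i / X i) (v := X) hp) ?pX ?mulr0 // => j.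
by apply: (mulfI Xi); rewrite XY; field.
Qed.

Definition distinct_points (T : ('I_3 -> C) -> Prop) s : bool :=
  all (fun X => `[< T X >]) s && pairwise (fun X Y => ~~ proj_eq X Y) s.

(** A list of maximal length is exhaustive. *)
Lemma exhaustive_points (T : ('I_3 -> C) -> Prop) N :
  (forall s, distinct_points T s -> (size s <= N)%N) ->
  exists2 s, distinct_points T s & forall X, T X -> has (proj_eq X) s.
Proof.
move=> bound; apply: contrapT => no.
suff [s [ds szs]] : exists s, distinct_points T s /\ size s = N.+1.
  by have := bound s ds; rewrite szs ltnn.
elim: N.+1 => [|n [s [ds szs]]]; first by exists [::].
have [[X TX /negP nX]|allX] := pselect (exists2 X, T X & ~ has (proj_eq X) s).
  exists (X :: s); split; last by rewrite /= szs.
  move: ds => /andP[Ts ps]; rewrite /distinct_points /= Ts ps !andbT.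
  by rewrite -[all _ s]negbK -has_predC (eq_has (a2 := proj_eq X)) ?nX
    ?andbT; [apply/asboolP|move=> Y /=; rewrite negbK].
case: no; exists s => // X TX; apply: contrapT => nX; apply: allX.
by exists X.
Qed.

Lemma linear_form_separating X Y : ~~ proj_eq X Y ->
  exists l : {mpoly C[3]}, [/\ l \is 1.-homog, l.@[Y] = 0 & l.@[X] != 0].
Proof.
move=> /forallPn[i /forallPn[j ne]].
exists (Y j *: 'X_i - Y i *: 'X_j); split.
- by apply: rpredB; apply: rpredZ; rewrite dhomogX /= mdeg1.
- by rewrite mevalB !mevalZ !mevalXU; ring.
- by rewrite mevalB !mevalZ !mevalXU subr_eq0 mulrC [Y i * _]mulrC.
Qed.

Lemma form_separating X s D : is_proj_point X ->
  all (fun Y => ~~ proj_eq X Y) s -> (size s <= D)%N ->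
  exists p : {mpoly C[3]}, [/\ p \is D.-homog, all (fun Y => p.@[Y] == 0) s
    & p.@[X] != 0].
Proof.
move=> [i Xi]; elim: s D => [|Y s IH] D /=.
  move=> _ _; exists ('X_i ^+ D); split=> //.
    have := @dhomogMn _ _ _ 1 'X_i D; rewrite mul1n; apply.
    by rewrite dhomogX /= mdeg1.
  by rewrite rmorphXn /= mevalXU expf_neq0.
case: D => // D /andP[/linear_form_separating[l [hl lY lX]] ne] /IH[//|p [hp ps pX]].
exists (l * p); split.
- by rewrite -[D.+1]add1n; apply: dhomogM.
- rewrite mevalM lY mul0r eqxx /=; apply: sub_all ps => Z /eqP pZ.
  by rewrite mevalM pZ mulr0.
- by rewrite mevalM mulf_neq0.
Qed.

(** A product of linear forms vanishes on [s] but not at one more given point, so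
    that each point imposes a new condition. *)
Lemma vanishing_space s D : distinct_points (@is_proj_point C) s -> (size s <= D)%N ->
  exists Z : {vspace S D}, (\dim Z + size s <= \dim {: S D})%N /\
    forall v : S D, v \in Z = all (fun X => (mpoly_of_dhomog v).@[X] == 0) s.
Proof.
rewrite /distinct_points; elim: s => [|X s IH] /=.
  by move=> _ _; exists fullv; split=> [|v]; rewrite ?addn0 ?memvf.
move=> /andP[/andP[/asboolP TX Ts] /andP[neX ps]] szD.
have [|Z [dimZ Zs]] := IH _ (ltnW szD); first by rewrite Ts.
pose ev (v : S D) : C^o := (mpoly_of_dhomog v).@[X].
have ev_lin : linear ev.
  by move=> c v v'; rewrite /ev /= mevalD mevalZ.
pose ev' : {linear S D -> C^o} := HB.pack ev (GRing.isLinear.Build _ _ _ _ ev ev_lin).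
exists (Z :&: lker (linfun ev'))%VS; split; last first.
  by move=> v; rewrite memv_cap Zs memv_ker lfunE /= andbC.
have [p [hp pv pX]] := form_separating TX neX (ltnW szD).
rewrite addnS -addSn (leq_trans _ dimZ) // leq_add2r.
rewrite ltn_neqAle dimvS ?capvSl // andbT; apply/eqP => e.
have : DHomog hp \in (Z :&: lker (linfun ev'))%VS.
  by rewrite (_ : _ :&: _ = Z)%VS ?Zs //; apply/eqP; rewrite eqEdim capvSl e leqnn.
by rewrite memv_cap memv_ker lfunE /= /ev /= (negbTE pX) andbF.
Qed.

(** The easy half of Bezout's theorem: distinct points impose independent
    conditions on the forms of large degree, and [(F, G)] has codimension
    [a b]. *)
Lemma bezout_bound a b F G s : F \is (a).-homog -> G \is b.-homog -> F != 0 ->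
  koszul_exact a b F G ->
  distinct_points (fun X => [/\ is_proj_point X, F.@[X] = 0 & G.@[X] = 0]) s ->
  (size s <= a * b)%N.
Proof.
move=> hF hG F0 kos ds.
have ds' : distinct_points (@is_proj_point C) s.
  move: ds => /andP[Ts ps]; apply/andP; split=> //.
  by apply: sub_all Ts => X /asboolP[PX _ _]; apply/asboolP.
have [|Z [dimZ Zs]] := @vanishing_space s (size s + a + b) ds'.
  by rewrite -addnA leq_addr.
have dimI := dim_ideal_part (size s) hF hG F0 kos.
have : (ideal_part a b (size s) F G <= Z)%VS.
  apply/subvP => v /(ideal_partP hF hG)[u [w vE]]; rewrite Zs vE.
  move: ds => /andP[Ts _]; apply: sub_all Ts => X /asboolP[_ FX GX].
  by rewrite mevalD !mevalM FX GX !mulr0 addr0.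
move=> /dimvS le; move: dimZ; rewrite -dimI => dimZ.
have := leq_trans (leq_add le (leqnn (size s))) dimZ.
by rewrite leq_add2l.
Qed.

(** Take [t = x_0 + c x_1 + c^2 x_2]: each point of [s] excludes the roots [c] of
    one nonzero polynomial. *)
Lemma generic_linear_form s : all (fun X => `[< is_proj_point X >]) s ->
  exists t : {mpoly C[3]}, t \is 1.-homog /\ all (fun X => t.@[X] != 0) s.
Proof.
move=> Ps; pose g X : {poly C} := \poly_(i < 3) X (inord i).
have g0 X : is_proj_point X -> g X != 0.
  move=> [i Xi]; apply: contraNneq Xi => gX; have := congr1 (coefp i) gX.
  by rewrite /= coef_poly coef0 ltn_ord inord_val => ->.
have : \prod_(X <- s) g X != 0.
  elim: s Ps => [|X s IH] /=; first by rewrite big_nil oner_neq0.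
  by move=> /andP[/asboolP/g0 gX /IH gs]; rewrite big_cons mulf_neq0.
move=> /closed_nonrootP[x /negP xr].
pose t : {mpoly C[3]} := \sum_(i < 3) x ^+ i *: 'X_i.
have tE X : t.@[X] = (g X).[x].
  rewrite /t raddf_sum /= horner_poly; apply: eq_bigr => i _.
  by rewrite mevalZ mevalXU inord_val mulrC.
exists t; split.
  by apply: rpred_sum => i _; apply: rpredZ; rewrite dhomogX /= mdeg1.
elim: s {Ps} xr => //= X s IH; rewrite big_cons => xr.
rewrite tE IH ?andbT; first by apply/negP => r; apply: xr; rewrite rootM /root r.
by move=> r; apply: xr; rewrite rootM r orbT.
Qed.

End ProjectivePoints.

(** * The residual intersection inequality *)

Section ResidualIntersection.
Variable C : closedFieldType.
Implicit Types (p q u v w g t : {mpoly C[3]}) (X Y : 'I_3 -> C).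
Implicit Types (s : seq ('I_3 -> C)).
Local Notation S d := (dhomog 3 C d).

Variables (a b h : nat) (F G H : {mpoly C[3]}).
Hypotheses (hF : F \is (a).-homog) (hG : G \is b.-homog) (hH : H \is h.-homog).
Hypothesis F0 : F != 0.
Hypotheses (kosFG : koszul_exact a b F G) (kosFH : koszul_exact a h F H).

(** In each degree, [d] linear conditions suffice to put a form [w] in the ideal
    that [F] and [G] generate in the local ring at [X]. Denominators of that
    local ring are cleared by [u], so that no chart has to be chosen. *)
Definition local_codim_le X (d : nat) : Prop := forall D,
  exists U : {vspace S D}, (\dim {: S D} <= \dim U + d)%N /\
    forall w : S D, w \in U -> exists u e,
      [/\ u \is e.-homog, u.@[X] != 0 & in_ideal F G (u * mpoly_of_dhomog w)].

(** The ideal quotient [(F, G) : H]. *)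
Definition residual g : Prop := in_ideal F G (g * H).

Lemma local_conditions s d D : all (fun X => `[< local_codim_le X d >]) s ->
  exists U : {vspace S D}, (\dim {: S D} <= \dim U + d * size s)%N /\
    forall w : S D, w \in U -> all (fun X => `[< exists u e,
      [/\ u \is e.-homog, u.@[X] != 0 & in_ideal F G (u * mpoly_of_dhomog w)] >]) s.
Proof.
elim: s => [|X s IH] /=; first by move=> _; exists fullv; split=> //; rewrite muln0 addn0.
move=> /andP[/asboolP/(_ D)[U [dimU UX]] /IH[V [dimV Vs]]].
exists (U :&: V)%VS; split.
  have := dimv_sum_cap U V; have := dimvS (subvf (U + V)%VS).
  by rewrite mulnS; lia.
by move=> w; rewrite memv_cap => /andP[/UX wU /Vs ->]; rewrite andbT; apply/asboolP.
Qed.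

(** The Koszul complexes of [(F, G)] and [(F, H)] write the same degree as
    different sums, whence the degree [D] given up to a propositional equality. *)
Lemma ideal_space D k : D = (k + a + b)%N -> exists A : {vspace S D},
  (\dim A + a * b <= \dim {: S D})%N /\
  forall w : S D, w \in A <-> in_ideal F G (mpoly_of_dhomog w).
Proof.
move=> ->; exists (ideal_part a b k F G); split; first exact: dim_ideal_part_le.
by move=> w; apply: ideal_partP.
Qed.

(** Let [U] be the forms [w] of large degree that satisfy the local conditions at
    the points of [s]: it has codimension at most [d * size s]. If [w] is in [U],
    then [H w] belongs to [(F, G)]: otherwise, for a linear form [t] without zeros
    on [F = G = 0], the ideal [(F, G) : H w] would have a zero [X] with
    [t(X) = 1]; it contains [residual], so that [X] is in [s], where a local
    denominator [u] with [u w] in [(F, G)] contradicts [u(X) = 0]. Hence [F S + H U]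
    lies in [(F, G)], which has codimension [a b], while it has codimension at
    most [d * size s] in [(F, H)], which has codimension [a h]. *)
Theorem residual_bound s d :
  (forall X, is_proj_point X ->
    (forall g e, g \is e.-homog -> residual g -> g.@[X] = 0) -> has (proj_eq X) s) ->
  all (fun X => `[< is_proj_point X >]) s ->
  all (fun X => `[< local_codim_le X d >]) s ->
  (a * b <= a * h + d * size s)%N.
Proof.
move=> sP sN sd.
have [zs dzs zsP] := exhaustive_points
  (fun s (ds : distinct_points _ s) => bezout_bound hF hG F0 kosFG ds).
have : all (fun X => `[< is_proj_point X >]) ((fun=> 1) :: zs).
  rewrite /= asboolT; last by exists ord0; apply: oner_neq0.
  move: dzs => /andP[Ts _]; apply: sub_all Ts => X /asboolP[PX _ _].
  exact/asboolP.
move=> /generic_linear_form[t [ht /= /andP[t1 tzs]]].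
have t0 : t != 0 by apply: contraNneq t1 => ->; rewrite meval0.
have tz X : F.@[X] = 0 -> G.@[X] = 0 -> t.@[X] = 0 -> forall i, X i = 0.
  move=> FX GX tX i; apply/eqP/negPn/negP => Xi.
  have PX : is_proj_point X by exists i.
  have : has (proj_eq X) zs by apply: zsP.
  have : all (fun X => `[< is_proj_point X >]) zs.
    move: dzs => /andP[Ts _]; apply: sub_all Ts => Y /asboolP[PY _ _].
    exact/asboolP.
  elim: (zs) tzs => //= Y z IH /andP[tY tz] /andP[/asboolP PY Pz] /orP[XY|]; last exact: IH.
  by move: tY; rewrite (proj_eq_vanish PX PY XY ht tX) eqxx.
have [E0 reg] := linear_form_regular hF hG F0 kosFG ht t0 tz.
pose k := (E0 + b)%N; pose D2 := (k + a)%N.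
have leE j : (E0 <= j + (D2 + h))%N by rewrite /D2 /k -!addnA addnCA leq_addr.
have [U [dimU Us]] := local_conditions D2 sd.
have UI (w : S D2) : w \in U -> in_ideal F G (mpoly_of_dhomog w * H).
  move=> wU; set w' := mpoly_of_dhomog w.
  have hw : w' \is D2.-homog := dhomog_is_dhomog w.
  pose I g := in_ideal F G (g * (w' * H)).
  have idI : is_ideal I.
    split=> [|p q|p q]; rewrite /I; first by rewrite mul0r; apply: in_ideal0.
      by rewrite mulrDl; apply: in_idealD.
    by rewrite -mulrA; apply: in_idealM.
  have subI p : in_ideal F G p -> I p by rewrite /I mulrC; apply: in_idealM.
  have [|g [r [Ig e1]]] := unit_on_chart hF hG F0 kosFG idI subI ht.
    move=> X IX; apply/negP => /eqP tX.
    have PX : is_proj_point X.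
      apply: contrapT => nX; have /eqP := tX; rewrite eq_sym.
      rewrite (mevalZ_homog (c := 0) (v := X) ht) ?expr1 ?mul0r ?oner_eq0 // => i.
      by rewrite mul0r; apply/eqP/negPn/negP => Xi; apply: nX; exists i.
    have : has (proj_eq X) s.
      apply: sP => // g e hg gH; apply: IX; rewrite /I mulrCA.
      exact: in_idealM.
    elim: (s) sN (Us w wU) => //= Y z IH /andP[/asboolP PY Pz] /andP[/asboolP[u [e [hu uY uw]]] Uz].
    move=> /orP[XY|]; last exact: IH.
    move: uY; rewrite (proj_eq_vanish PX PY XY hu) ?eqxx //; apply: IX.
    by rewrite /I mulrA mulrC; apply: in_idealM.
  have hwH : w' * H \is (D2 + h).-homog by apply: dhomogM.
  have Ih p e : in_ideal F G p -> in_ideal F G (pihomog mdeg e p).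
    exact: in_ideal_pihomog hF hG.
  have [|j] := homogeneous_rabinowitsch (is_ideal_in_ideal F G) Ih ht hwH.
    exists (g * (w' * H)), (r * (w' * H)); split=> //.
    by rewrite -[LHS]mul1r [X in X * _ = _]e1; ring.
  elim: j => [|j IH]; first by rewrite expr0 mul1r.
  rewrite exprS -mulrA => tI; apply: IH; apply: (reg _ _ (leE j) _ tI).
  by have := dhomogM (dhomogMn j ht) hwH; rewrite mul1n; apply.
have swap x y z n : (x + y + z + n = x + n + z + y)%N by clear; lia.
have [A [dimA AP]] := ideal_space (swap E0 b a h).
rewrite -/k in A dimA AP.
pose f (w : S D2) : S (k + a + h) := proj _ (mpoly_of_dhomog w * H).
have f_lin : linear f.
  by move=> x w w'; rewrite /f -linearP; congr proj; rewrite /= mulrDl scalerAl.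
have fE (w : S D2) : mpoly_of_dhomog (f w) = mpoly_of_dhomog w * H.
  rewrite val_proj //; exact: dhomogM (dhomog_is_dhomog _) hH.
pose f' : {linear S D2 -> S (k + a + h)} := HB.pack f (GRing.isLinear.Build _ _ _ _ f f_lin).
have sub : (ideal_part a h k F H <= A + (linfun f' @: U^C))%VS.
  apply/subvP => p /(ideal_partP hF hH)[u [v pE]].
  have /memv_addP[w1 w1U [w2 w2U wE]] : proj D2 v \in (U + U^C)%VS.
    by rewrite addv_complf memvf.
  apply/memv_addP; exists (p - f w2).
    apply/AP; rewrite (_ : mpoly_of_dhomog _ = pihomog mdeg (k + a + h) (u * F)
      + mpoly_of_dhomog w1 * H).
      apply: in_idealD; last exact: UI.
      apply: in_ideal_pihomog hF hG _.
      by apply: in_idealM; apply: in_ideal_gen1.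
    transitivity (mpoly_of_dhomog p - mpoly_of_dhomog (f w2)) => //; rewrite fE.
    have -> : mpoly_of_dhomog p = pihomog mdeg (k + a + h) (u * F)
        + pihomog mdeg D2 v * H.
      rewrite -(pihomogM _ _ hH) -raddfD -pE /=.
      by rewrite pihomog_dE //; apply: dhomog_is_dhomog.
    have -> : pihomog mdeg D2 v = mpoly_of_dhomog w1 + mpoly_of_dhomog w2.
      by have /= := congr1 (fun z : S D2 => mpoly_of_dhomog z) wE.
    by ring.
  exists (f w2); first by apply/memv_imgP; exists w2; rewrite ?lfunE.
  by rewrite subrK.
have dimFH := dim_ideal_part k hF hH F0 kosFH.
have le1 := dimvS sub.
have le2 := leq_trans le1 (dimv_add_leqif A (linfun f' @: U^C)%VS).1.
have arith1 (x y c n u e : nat) :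
  (c = n - u -> n <= u + e -> x + y = c -> y <= e)%N by clear; lia.
have arith2 (x y z n e c i : nat) :
  (z + x <= n -> i + y = n -> i <= z + c -> c <= e -> x <= y + e)%N by clear; lia.
apply: arith2 dimA dimFH le2 _.
exact: arith1 (dimv_compl U) dimU (limg_ker_dim (linfun f') (U^C)%VS).
Qed.

End ResidualIntersection.

(** * From intersection numbers to linear conditions *)

Lemma clear_denominators (K : fieldType) (q1 q2 p1 p2 g l : K) :
  q1 != 0 -> q2 != 0 ->
  q1 * q2 * (p1 / q1 * g + p2 / q2 * l) = p1 * q2 * g + p2 * q1 * l.
Proof. by move=> q10 q20; field; rewrite q10 q20. Qed.

Section LocalConditions.
Variable C : closedFieldType.
Implicit Types (i : 'I_3) (X : 'I_3 -> C) (x : 'I_2 -> C) (g l p q : {mpoly C[2]}).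
Implicit Types (h u v : {fraction {mpoly C[2]}}).
Local Notation "x %:F" := (tofrac x).
Local Notation S d := (dhomog 3 C d).

Lemma local_ring_poly x p : local_ring x p%:F.
Proof. by exists p, 1; rewrite meval1 oner_neq0 tofrac1 divr1. Qed.

Lemma local_ringD x u v : local_ring x u -> local_ring x v -> local_ring x (u + v).
Proof.
move=> [p [q [qx ->]]] [p' [q' [qx' ->]]].
exists (p * q' + p' * q), (q * q'); split; first by rewrite mevalM mulf_neq0.
have nz r : r.@[x] != 0 -> r%:F != 0.
  by rewrite tofrac_eq0; apply: contraNneq => ->; rewrite meval0.
rewrite addf_div ?nz //; by rewrite tofracM tofracD !tofracM.
Qed.

Lemma local_ringM x p u : local_ring x u -> local_ring x (p%:F * u).
Proof.
move=> [p' [q [qx ->]]]; exists (p * p'), q; split=> //.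
by rewrite tofracM mulrA.
Qed.

Lemma local_idealD x g l u v :
  local_ideal x g l u -> local_ideal x g l v -> local_ideal x g l (u + v).
Proof.
move=> [u1 [u2 [l1 l2 ->]]] [v1 [v2 [l1' l2' ->]]].
exists (u1 + v1), (u2 + v2); split; [exact: local_ringD|exact: local_ringD|ring].
Qed.

Lemma local_idealM x g l p u : local_ideal x g l u -> local_ideal x g l (p%:F * u).
Proof.
move=> [u1 [u2 [l1 l2 ->]]]; exists (p%:F * u1), (p%:F * u2).
by split; [exact: local_ringM|exact: local_ringM|ring].
Qed.

Lemma local_ideal_clear x g l p : local_ideal x g l p%:F ->
  exists q r s, q.@[x] != 0 /\ q * p = r * g + s * l.
Proof.
move=> [u [v [[p1 [q1 [q1x ->]]] [p2 [q2 [q2x ->]]] e]]].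
exists (q1 * q2), (p1 * q2), (p2 * q1); split; first by rewrite mevalM mulf_neq0.
have nz r : r.@[x] != 0 -> r%:F != 0.
  by rewrite tofrac_eq0; apply: contraNneq => ->; rewrite meval0.
apply/eqP; rewrite -tofrac_eq tofracD !tofracM e; apply/eqP.
exact: clear_denominators (nz _ q1x) (nz _ q2x).
Qed.

(** The coordinates of a form in a basis of the local quotient are linear because
    they are unique; where they vanish, the form is in the local ideal, and
    homogenizing a common denominator gives [u]. *)
Lemma local_quotient_codim a b (F G : {mpoly C[3]}) i X d :
  F \is (a).-homog -> G \is b.-homog -> X i != 0 ->
  local_quotient_dim (chart i X) (dehomogenize i F) (dehomogenize i G) d ->
  local_codim_le F G X d.
Proof.
move=> hF hG Xi [e [he hu]] D; set x := chart i X.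
pose g := dehomogenize i F; pose l := dehomogenize i G.
pose dh (w : S D) := dehomogenize i (mpoly_of_dhomog w).
pose rem (w : S D) (c : {ffun 'I_d -> C}) :=
  local_ideal x g l ((dh w)%:F - \sum_j ((c j)%:MP)%:F * e j).
have ex w : exists! c, rem w c by apply: hu; exact: local_ring_poly.
pose kap w := projT1 (cid (ex w)).
have kapP w : rem w (kap w) := (projT2 (cid (ex w))).1.
have kapU w c : rem w c -> kap w = c := (projT2 (cid (ex w))).2 c.
pose f (w : S D) : 'rV[C]_d := \row_j kap w j.
have f_lin : linear f.
  move=> z w w'; rewrite /f (kapU _ [ffun j => z * kap w j + kap w' j]).
    by apply/rowP => j; rewrite !mxE ffunE.
  have := local_idealD (local_idealM z%:MP (kapP w)) (kapP w').
  rewrite /rem; congr local_ideal.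
  rewrite /dh /= linearP /= tofracD -mul_mpolyC tofracM mulrBr addrACA -opprD.
  congr (_ - _); rewrite mulr_sumr -big_split /=; apply: eq_bigr => j _.
  by rewrite ffunE mpolyCD mpolyCM tofracD tofracM mulrDl mulrA.
pose f' : {linear S D -> 'rV[C]_d} := HB.pack f (GRing.isLinear.Build _ _ _ _ f f_lin).
exists (lker (linfun f')); split.
  rewrite -(limg_ker_dim (linfun f') fullv) capfv leq_add2l.
  apply: leq_trans (dimvS (subvf _)) _; rewrite dimvf.
  by rewrite /dim /= mul1n.
move=> w; rewrite memv_ker lfunE /= => /eqP /rowP fw0.
have : local_ideal x g l (dh w)%:F.
  have := kapP w; rewrite /rem big1 ?subr0 // => j _.
  by have := fw0 j; rewrite !mxE => ->; rewrite mpolyC0 tofrac0 mul0r.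
move=> /local_ideal_clear[q [r [s [qx qE]]]].
pose M := (msize q + msize r + msize s)%N.
exists (homogen i (M + a + b) q), (M + a + b)%N.
have hw := dhomog_is_dhomog w.
split; first by apply: homogen_homog; rewrite /M; lia.
  by rewrite homogen_eval ?mulf_neq0 ?expf_neq0 // /M; lia.
exists (homogen i (M + b + D) r), (homogen i (M + a + D) s).
apply: (@dehomogenize_inj _ i (M + a + b + D)).
- by apply: dhomogM => //; apply: homogen_homog; rewrite /M; lia.
- apply: rpredD.
    rewrite (_ : (M + a + b + D = M + b + D + a)%N); last by lia.
    by apply: dhomogM => //; apply: homogen_homog; rewrite /M; lia.
  rewrite (_ : (M + a + b + D = M + a + D + b)%N); last by lia.
  by apply: dhomogM => //; apply: homogen_homog; rewrite /M; lia.
- by rewrite rmorphD !rmorphM /= !homogenK.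
Qed.

Lemma intersection_number_le x g l (K : int) :
  (intersection_number g l x <= K%:E)%E ->
  exists d, local_quotient_dim x g l d /\ (d%:Z <= K)%R.
Proof.
rewrite /intersection_number; case: pselect => // h.
by rewrite lee_fin => le; exists (sval (cid h)); split=> //; exact: (svalP (cid h)).
Qed.

Lemma local_codim_leW (F G : {mpoly C[3]}) X d d' : (d <= d')%N ->
  local_codim_le F G X d -> local_codim_le F G X d'.
Proof.
move=> le loc D; have [U [dimU UP]] := loc D; exists U; split=> //.
by rewrite (leq_trans dimU) // leq_add2l.
Qed.

End LocalConditions.

(** * Derivatives, Euler's identity and invariant singular points *)

Section Derivatives.
Variable C : numClosedFieldType.
Implicit Types (f p q : {mpoly C[2]}) (w : {mpoly C[3]}).

Lemma lift_iz0 : lift iz (ord0 : 'I_2) = ix.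
Proof. exact: val_inj. Qed.

Lemma lift_iz1 : lift iz (ord_max : 'I_2) = iy.
Proof. by apply: val_inj; rewrite /= /iy inordK. Qed.

Lemma ord3P (j : 'I_3) : [\/ j = ix, j = iy | j = iz].
Proof.
case: (unliftP iz j) => [k|] ->; last by constructor 3.
by case: (ord2P k) => ->; rewrite ?lift_iz0 ?lift_iz1; [constructor 1|constructor 2].
Qed.

Lemma big_ord3 (R : Type) (idx : R) (op : Monoid.com_law idx) (E : 'I_3 -> R) :
  \big[op/idx]_(j < 3) E j = op (op (E ix) (E iy)) (E iz).
Proof.
rewrite (bigD1_ord iz) //= Monoid.mulmC !big_ord_recl big_ord0 Monoid.mulm1.
rewrite lift_iz0 (_ : lift ord0 ord0 = ord_max :> 'I_2) ?lift_iz1 //.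
exact: val_inj.
Qed.

Lemma homogenizeE f : homogenize f = homogen iz (msize f).-1 f.
Proof.
rewrite /homogenize /homogen; apply: eq_bigr => k _; congr (_ *: _).
pose d := (msize f).-1; rewrite -/d.
have e0 : homog_mnm iz d k ix = k ord0 by rewrite mnmE -lift_iz0 liftK.
have e1 : homog_mnm iz d k iy = k ord_max by rewrite mnmE -lift_iz1 liftK.
have e2 : homog_mnm iz d k iz = (d - mdeg k)%N by rewrite mnmE unlift_none.
by rewrite [in RHS]mpolyXE_id big_ord3 /= e0 e1 e2.
Qed.

Lemma mderiv_dehomogenize i k w :
  (dehomogenize i w)^`M(k) = dehomogenize i (w^`M(lift i k)).
Proof.
rewrite [w]mpolyE (raddf_sum (dehomogenize i)) (raddf_sum (mderiv (lift i k))) /=.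
rewrite (raddf_sum (mderiv k)) (raddf_sum (dehomogenize i)) /=.
apply: eq_bigr => m _; rewrite linearZ /= dehomogenizeX !mderivZ !mderivX !linearZ /=.
rewrite dehomogenizeX mnmE [LHS]scalerA mulrC -scalerA.
congr (_ *: (_ *: 'X_[_])); apply/mnmP => j.
by rewrite !(mnmBE, mnmE) (inj_eq lift_inj).
Qed.

Lemma mderiv_homog d j w : w \is d.-homog -> w^`M(j) \is d.-1.-homog.
Proof.
move=> /dhomogP hw; apply/dhomogP => m.
rewrite mcoeff_msupp mcoeff_deriv => nz.
have : (m + U_(j))%MM \in msupp w.
  by rewrite mcoeff_msupp; apply: contraNneq nz => ->; rewrite mul0rn.
by move=> /hw /= <-; rewrite mdegD mdeg1 addn1.
Qed.

Lemma euler_identity d w : w \is d.-homog ->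
  'X_ix * w^`M(ix) + 'X_iy * w^`M(iy) + 'X_iz * w^`M(iz) = d%:R *: w.
Proof.
move=> /dhomogP hw; rewrite [X in _ = _ *: X]mpolyE scaler_sumr.
rewrite -(big_ord3 _ (fun j => 'X_j * w^`M(j))) /=.
transitivity (\sum_j \sum_(m <- msupp w) w@_m *: ((m j)%:R *: 'X_[C, m])).
  apply: eq_bigr => j _; rewrite [in LHS](mpolyE w) !raddf_sum mulr_sumr /=.
  apply: eq_bigr => m _; rewrite linearZ /= mderivX -scalerAr -scalerAr.
  congr (_ *: _); have [->|mj] := posnP (m j); first by rewrite !scale0r.
  congr (_ *: _); rewrite -mpolyXD; congr 'X_[_]; rewrite addmC submK //.
  by apply/mnm_lepP => i; rewrite mnm1E; case: eqP => // <-.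
rewrite exchange_big big_seq [RHS]big_seq; apply: eq_bigr => m /hw /= <-.
rewrite -scaler_sumr -scaler_suml -natr_sum -mdegE.
by rewrite scalerA mulrC -scalerA.
Qed.

Lemma msize_mderiv n j (p : {mpoly C[n]}) : (msize p^`M(j) <= (msize p).-1)%N.
Proof.
rewrite [leqLHS]msizeE; apply/bigmax_leqP_seq => m.
rewrite mcoeff_msupp mcoeff_deriv => nz _.
have : (m + U_(j))%MM \in msupp p.
  by rewrite mcoeff_msupp; apply: contraNneq nz => ->; rewrite mul0rn.
by move=> /msize_mdeg_lt; rewrite mdegD mdeg1; lia.
Qed.

(** Such an [f] is a polynomial in [x] alone, which splits over [C]; being
    irreducible, it is a multiple of some [x - a]. *)
Lemma irreducible_mderiv_eq0 f : mirreducible f -> f^`M(ord_max) = 0 -> msize f = 2%N.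
Proof.
move=> [ncf irr] fy.
have my m : m \in msupp f -> m ord_max = 0%N.
  rewrite mcoeff_msupp; apply: contraNeq; rewrite -lt0n => m1.
  have := congr1 (mcoeff (m - U_(ord_max))%MM) fy.
  rewrite mcoeff_deriv submK ?mcoeff0; last first.
    by apply/mnm_lepP => i; rewrite mnm1E; case: eqP => // <-.
  by move/eqP; rewrite mulrn_eq0.
pose c : {poly C} := mmap polyC (fun i : 'I_2 => if i == ord0 then 'X else 0) f.
have fE : f = of_poly1 c.
  rewrite [LHS]mpolyE /c /mmap (rmorph_sum (@of_poly1 C)) /= big_seq [RHS]big_seq.
  apply: eq_bigr => m /my m1; rewrite rmorphM /= of_poly1C mul_mpolyC; congr (_ *: _).
  rewrite /mmap1 mpolyXE_id !big_ord_recl !big_ord0 !mulr1.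
  have -> : lift ord0 (ord0 : 'I_1) = ord_max :> 'I_2 by apply: val_inj.
  by rewrite m1 /= !expr0 !mulr1 rmorphXn /= of_poly1X.
have /closed_rootP[a /factor_theorem[c' cE]] : size c != 1%N.
  apply: contraL ncf => /size_poly1P[b b0 cb].
  by rewrite /nonconstant fE cb of_poly1C msizeC b0.
pose L : {mpoly C[2]} := 'X_ord0 - a%:MP.
have szL : msize L = 2%N.
  apply/anti_leq/andP; split.
    rewrite (leq_trans (msizeD_le _ _)) // msizeN geq_max msizeX mdeg1 msizeC.
    by rewrite (leq_trans (leq_b1 _)).
  have := @msize_mdeg_lt _ _ L U_(ord0); rewrite mdeg1; apply.
  rewrite mcoeff_msupp mcoeffB mcoeffXU mcoeffC eqxx mnm1_eq0 mulr0 subr0.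
  exact: oner_neq0.
have fE' : f = of_poly1 c' * L.
  by rewrite fE cE rmorphM rmorphB /= of_poly1X of_poly1C.
have [/andP[/eqP uE] |/(negP (nonconstant_nonunit _))[]] := irr _ _ fE'; last first.
  by rewrite /nonconstant szL.
rewrite unitfE => u0; rewrite fE' uE mul_mpolyC msizeZ //.
Qed.

Local Notation fx f := (f^`M(ord0)).
Local Notation fy f := (f^`M(ord_max)).

Definition derivation (P Q p : {mpoly C[2]}) := P * fx p + Q * fy p.

Lemma derivationM P Q p q :
  derivation P Q (p * q) = derivation P Q p * q + p * derivation P Q q.
Proof. by rewrite /derivation !mderivM; ring. Qed.

Lemma derivationD P Q p q :
  derivation P Q (p + q) = derivation P Q p + derivation P Q q.
Proof. by rewrite /derivation !mderivD; ring. Qed.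

Lemma derivation_shift P Q (a : C) (j : 'I_2) :
  derivation P Q ('X_j - a%:MP) = if j == ord0 then P else Q.
Proof.
rewrite /derivation !mderivB !mderivC !subr0 !mderivX !mnm1E.
case: (ord2P j) => ->; rewrite /= ?scale0r ?scale1r ?mulr0 ?add0r ?addr0.
  by rewrite (_ : (_ - _)%MM = 0%MM) ?mpolyX0 ?mulr1 //; apply/mnmP => i; rewrite mnmBE subnn mnm0E.
by rewrite (_ : (_ - _)%MM = 0%MM) ?mpolyX0 ?mulr1 //; apply/mnmP => i; rewrite mnmBE subnn mnm0E.
Qed.

Definition jacobian_ideal f p : Prop :=
  exists u v r : {mpoly C[2]}, p = u * f + v * fx f + r * fy f.

Lemma is_ideal_jacobian f : is_ideal (jacobian_ideal f).
Proof.
split.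
- by exists 0, 0, 0; ring.
- move=> _ _ [u [v [w ->]]] [u' [v' [w' ->]]].
  by exists (u + u'), (v + v'), (w + w'); ring.
- by move=> _ p [u [v [w ->]]]; exists (p * u), (p * v), (p * w); ring.
Qed.

(** Differentiating [P f_x + Q f_y = k f] shows that the derivation of an
    invariant curve preserves its Jacobian ideal. *)
Lemma derivation_jacobian P Q f k : P * fx f + Q * fy f = k * f ->
  forall p, jacobian_ideal f p -> jacobian_ideal f (derivation P Q p).
Proof.
move=> inv _ [u [v [w ->]]]; have [_ JD JM] := is_ideal_jacobian f.
have Jf : jacobian_ideal f f by exists 1, 0, 0; ring.
have Jx : jacobian_ideal f (fx f) by exists 0, 1, 0; ring.
have Jy : jacobian_ideal f (fy f) by exists 0, 0, 1; ring.
have Df : jacobian_ideal f (derivation P Q f) by rewrite /derivation inv; apply: JM.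
have Dx : jacobian_ideal f (derivation P Q (fx f)).
  have := congr1 (mderiv ord0) inv; rewrite mderivD !mderivM => e.
  exists (fx k), (k - fx P), (- fx Q); rewrite /derivation [fy (fx f)]mderiv_comm.
  by rewrite -[LHS]addr0 -(subrr (fx k * f + k * fx f)) -{2}e; ring.
have Dy : jacobian_ideal f (derivation P Q (fy f)).
  have := congr1 (mderiv ord_max) inv; rewrite mderivD !mderivM => e.
  exists (fy k), (- fy P), (k - fy Q); rewrite /derivation [fx (fy f)]mderiv_comm.
  by rewrite -[LHS]addr0 -(subrr (fy k * f + k * fy f)) -{2}e; ring.
have Dmul q r : jacobian_ideal f r -> jacobian_ideal f (derivation P Q r) ->
    jacobian_ideal f (derivation P Q (q * r)).
  by move=> Jr JDr; rewrite derivationM; apply: (JD); apply: (JM).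
by rewrite !derivationD; apply: (JD); [apply: (JD)|]; apply: Dmul.
Qed.

(** If the vector field were transverse to the fibers of [X_j] at a singular
    point, deriving the relation [(X_j - a)^N = 0] in the local ring modulo the
    Jacobian ideal would lower [N], down to [1 = 0]. *)
Lemma singular_point_stationary P Q f k (X : 'I_2 -> C) (j : 'I_2) (c : {poly C}) :
  P * fx f + Q * fy f = k * f ->
  f.@[X] = 0 -> (fx f).@[X] = 0 -> (fy f).@[X] = 0 ->
  c != 0 -> jacobian_ideal f (poly_at c 'X_j) ->
  (if j == ord0 then P else Q).@[X] = 0.
Proof.
move=> inv f0 fx0 fy0 c0 Jc; apply/eqP/negPn/negP; set R := if _ then _ else _ => RX.
have JX p : jacobian_ideal f p -> p.@[X] = 0.
  by move=> [u [v [w ->]]]; rewrite !mevalD !mevalM f0 fx0 fy0; ring.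
have [_ JD JM] := is_ideal_jacobian f.
pose L : {mpoly C[2]} := 'X_j - (X j)%:MP.
have descent N u : u.@[X] != 0 -> ~ jacobian_ideal f (u * L ^+ N).
  elim: N u => [|N IH] u uX Ju.
    by move: uX; rewrite -[u]mulr1 -[1](expr0 L) (JX _ Ju) eqxx.
  have DL M : derivation P Q (L ^+ M.+1) = M.+1%:R * L ^+ M * R.
    elim: M => [|M IHM]; first by rewrite expr1 derivation_shift expr0 !mul1r.
    rewrite exprS derivationM IHM derivation_shift -/R exprS.
    by rewrite [M.+2%:R]mulrS; ring.
  apply: (IH (N.+1%:R * u * u * R)).
    rewrite !mevalM -mpolyC_nat mevalC !mulf_neq0 //; by rewrite pnatr_eq0.
  have := derivation_jacobian inv Ju; rewrite derivationM DL => Ju'.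
  have := JD _ _ (JM _ u Ju') (JM _ (- derivation P Q u) Ju).
  by congr jacobian_ideal; ring.
have [N [c1 c1X cE]] := multiplicity_XsubC c (X j).
rewrite c0 /= in c1X.
apply: (descent N (poly_at c1 'X_j)).
  rewrite /poly_at; move: c1X; rewrite /root; apply: contra => /eqP e; apply/eqP.
  rewrite -[RHS]e -horner_map /= -map_poly_comp mevalXU map_poly_id // => x _ /=.
  by rewrite mevalC.
move: Jc; rewrite /poly_at cE rmorphM rmorphXn rmorphB /= map_polyX map_polyC.
by rewrite hornerM horner_exp hornerXsubC.
Qed.

End Derivatives.

(** * Singular points at infinity *)

Section DoubleRoots.
Variable K : fieldType.
Implicit Types (p q : {poly K}) (rs : seq K).

Lemma double_root_factor p x : root p x -> root p^`() x ->
  exists q, p = ('X - x%:P) ^+ 2 * q.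
Proof.
move=> /factor_theorem[q ->]; rewrite derivM derivXsubC mulr1 /root.
rewrite hornerD hornerM hornerXsubC subrr mulr0 add0r => /factor_theorem[q' ->].
by exists q'; ring.
Qed.

Lemma double_roots_bound p rs : p != 0 -> uniq rs ->
  all (fun x => root p x && root p^`() x) rs -> ((size rs).*2 < size p)%N.
Proof.
elim: rs p => [|x rs IH] p p0 /=; first by rewrite lt0n size_poly_eq0.
move=> /andP[xrs urs] /andP[/andP[px p'x] prs].
have [q pE] := double_root_factor px p'x.
have q0 : q != 0 by apply: contraNneq p0 => q0; rewrite pE q0 mulr0.
have szp : size p = (size q).+2.
  rewrite pE size_proper_mul; last by rewrite mulf_neq0 ?lead_coef_eq0 ?expf_neq0 ?polyXsubC_eq0.
  by rewrite size_exp_XsubC.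
rewrite szp doubleS !ltnS; apply: IH => //.
apply/allP => y yrs; have /allP/(_ _ yrs)/andP[] := prs.
have yx : y - x != 0 by rewrite subr_eq0; apply: contraNneq xrs => <-.
rewrite /root pE derivM deriv_exp derivXsubC !hornerE /= mulf_eq0.
rewrite expf_eq0 (negbTE yx) /= => /eqP qy.
by rewrite qy mulr0 add0r mulf_eq0 expf_eq0 (negbTE yx) /= eqxx => ->.
Qed.

End DoubleRoots.

Section PointsAtInfinity.
Variable C : numClosedFieldType.
Implicit Types (f : {mpoly C[2]}) (w : {mpoly C[3]}) (X : 'I_3 -> C).

Definition mnm2 (i j : nat) : 'X_{1..2} := [multinom if k == ord0 then i else j | k < 2].

Lemma mdeg_mnm2 i j : mdeg (mnm2 i j) = (i + j)%N.
Proof. by rewrite mdegE !big_ord_recl big_ord0 !mnmE /= addn0. Qed.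

Lemma mnm2_surj (m : 'X_{1..2}) : m = mnm2 (m ord0) (m ord_max).
Proof. by apply/mnmP => k; rewrite mnmE; case: (ord2P k) => ->. Qed.

Lemma eval_at_infinity d w X : w \is d.-homog -> X iz = 0 ->
  w.@[X] = \sum_(i < d.+1) (dehomogenize iz w)@_(mnm2 i (d - i)) *
             (X ix ^+ i * X iy ^+ (d - i)).
Proof.
move=> hw Xz; pose M (i : 'I_d.+1) := homog_mnm iz d (mnm2 i (d - i)).
have dM i : mdeg (M i) = d.
  by rewrite mdeg_homog_mnm // mdeg_mnm2 subnKC // -ltnS.
have Mx i : M i ix = i by rewrite -lift_iz0 mnmE liftK mnmE.
have My i : M i iy = (d - i)%N by rewrite -lift_iz1 mnmE liftK mnmE.
have Mz i : M i iz = 0%N.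
  by rewrite mnmE unlift_none mdeg_mnm2 subnKC ?subnn // -ltnS.
pose ev (m : 'X_{1..3}) := \prod_j X j ^+ m j.
have evM i : ev (M i) = X ix ^+ i * X iy ^+ (d - i).
  by rewrite /ev big_ord3 /= Mx My Mz expr0 mulr1.
transitivity (\sum_(i < d.+1) w@_(M i) * ev (M i)); last first.
  apply: eq_bigr => i _; rewrite evM; congr (_ * _).
  by rewrite -(mcoeff_dehomogenize iz hw (dM i)) homog_mnmK.
have term i : w@_(M i) * ev (M i) = \sum_(m <- msupp w) w@_m * ((m == M i)%:R * ev m).
  rewrite [in LHS](mpolyE w) raddf_sum /= mulr_suml; apply: eq_bigr => m _.
  rewrite mcoeffZ mcoeffX -mulrA; congr (_ * _).
  by case: eqP => [->|]; rewrite ?mul0r.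
rewrite (eq_bigr _ (fun i _ => term i)) exchange_big /= mevalE.
rewrite big_seq [RHS]big_seq; apply: eq_bigr => m mw.
rewrite -mulr_sumr; congr (_ * _); rewrite -mulr_suml -/(ev m).
have dm : mdeg m = d by move: mw; move/dhomogP: hw => hw /hw.
have [mz|mz] := posnP (m iz); last first.
  suff -> : ev m = 0 by rewrite mulr0.
  by rewrite /ev big_ord3 /= Xz expr0n gtn_eqF // mulr0.
have mx : (m ix < d.+1)%N.
  by rewrite ltnS -dm mdegE big_ord3 /= -addnA leq_addr.
rewrite (bigD1 (Ordinal mx)) //= big1 ?addr0 => [|i /eqP ne].
  suff /eqP -> : m = M (Ordinal mx) by rewrite mul1r.
  apply/mnmP => j; case: (ord3P j) => ->; rewrite ?Mx ?My ?Mz //=.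
  by rewrite -dm mdegE big_ord3 /= mz addn0 addKn.
by case: eqP => // mM; case: ne; apply: val_inj; rewrite /= mM Mx.
Qed.

(** The leading form of [f] at [(x, 1)], when [n] is the degree of [f]. *)
Definition top_poly f n : {poly C} := \poly_(i < n.+1) f@_(mnm2 i (n - i)).

Lemma horner_top w n X : w \is n.-homog -> X iz = 0 -> X iy != 0 ->
  w.@[X] = X iy ^+ n * (top_poly (dehomogenize iz w) n).[X ix / X iy].
Proof.
move=> hw Xz Xy; rewrite (eval_at_infinity hw Xz) horner_poly mulr_sumr.
apply: eq_bigr => i _; rewrite [RHS]mulrCA; congr (_ * _).
rewrite expr_div_n [RHS]mulrCA; congr (_ * _).
have -> : X iy ^+ n = X iy ^+ (n - i) * X iy ^+ i by rewrite -exprD subnK // -ltnS.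
by rewrite mulfK // expf_neq0.
Qed.

Lemma deriv_top f n : (0 < n)%N -> (top_poly f n)^`() = top_poly f^`M(ord0) n.-1.
Proof.
case: n => // n _; apply/polyP => i; rewrite coef_deriv !coef_poly /= [(i.+1 < n.+2)%N]ltnS.
case: ifP => lei; last exact: mul0rn.
rewrite mcoeff_deriv mnmE eqxx subSS; congr (f@_ _ *+ _).
by apply/mnmP => k; rewrite mnmDE mnm1E !mnmE; case: (ord2P k) => -> /=; rewrite ?addn1 ?addn0.
Qed.

Lemma eval_on_axis d w X : w \is d.-homog -> X iz = 0 -> X iy = 0 ->
  w.@[X] = (dehomogenize iz w)@_(mnm2 d 0) * X ix ^+ d.
Proof.
move=> hw Xz Xy; rewrite (eval_at_infinity hw Xz) big_ord_recr /= subnn.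
rewrite big1 ?add0r => [|i _]; first by rewrite expr0 mulr1.
by rewrite Xy expr0n subn_eq0 leqNgt ltn_ord /= !mulr0.
Qed.

(** A singular point at infinity is a double root of the leading form of [f],
    which has degree [n]. The roots with [y <> 0] are double roots of
    [top_poly f n]; the remaining possible one, [(1 : 0 : 0)], instead lowers the
    degree of [top_poly f n] to at most [n - 2]. *)
Lemma singular_at_infinity_bound f n s : (0 < n)%N -> msize f = n.+1 ->
  distinct_points (fun X => [/\ is_proj_point X, X iz = 0 & Sing f X]) s ->
  ((size s).*2 <= n)%N.
Proof.
move=> n_gt0 szf ds; set F := homogenize f.
have FE : F = homogen iz n f by rewrite /F homogenizeE szf.
have hF : F \is n.-homog by rewrite FE; apply: homogen_homog; rewrite szf.
have dF : dehomogenize iz F = f by rewrite FE homogenK.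
have dFj k : dehomogenize iz (F^`M(lift iz k)) = f^`M(k).
  by rewrite -mderiv_dehomogenize dF.
set p := top_poly f n.
have f0 : f != 0 by rewrite -msize_poly_eq0 szf.
have p0 : p != 0.
  have := mlead_deg f0; rewrite szf => -[dm].
  have := mleadc_eq0 f; rewrite (negbTE f0); apply: contraFneq => pz.
  have md : mdeg (mlead f) = (mlead f ord0 + mlead f ord_max)%N.
    by rewrite {1}[mlead f]mnm2_surj mdeg_mnm2.
  have := congr1 (coefp (mlead f ord0)) pz; rewrite /= coef0 coef_poly -dm.
  rewrite md ltnS leq_addr addKn -mnm2_surj => ->.
  exact: eqxx.
pose s1 := [seq X <- s | X iy != 0]; pose s2 := [seq X <- s | X iy == 0].
have szs : size s = (size s1 + size s2)%N.
  by rewrite !size_filter addnC -(count_predC (fun X => X iy == 0) s).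
have dsf (a : pred ('I_3 -> C)) : distinct_points
    (fun X => [/\ is_proj_point X, X iz = 0 & Sing f X]) [seq X <- s | a X].
  move: ds => /andP[Ts ps]; apply/andP; split; last exact: pairwise_filter.
  by rewrite all_filter; apply: sub_all Ts => X /= ->; rewrite implybT.
pose rs := [seq X ix / X iy | X : 'I_3 -> C <- s1].
have urs : uniq rs.
  rewrite uniq_pairwise pairwise_map.
  have /andP[Ts1 ps1] := dsf (fun X => X iy != 0).
  apply: (@sub_in_pairwise _ (fun X => (X iz == 0) && (X iy != 0))) ps1.
    move=> X Y /andP[/eqP Xz Xy] /andP[/eqP Yz Yy]; apply: contra => /eqP e.
    have e' : X ix * Y iy = X iy * Y ix.
      by apply: (mulIf (invr_neq0 Xy)); apply: (mulIf (invr_neq0 Yy));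
        transitivity (X ix / X iy); [field|rewrite e; field]; rewrite ?Xy ?Yy.
    apply/proj_eqP => i j; case: (ord3P i) => ->; case: (ord3P j) => ->;
      rewrite ?Xz ?Yz ?mul0r ?mulr0 //; by rewrite ?e' mulrC // -e' mulrC.
  rewrite all_filter; move: ds => /andP[Ts _]; apply: sub_all Ts.
  by move=> X /asboolP[_ Xz _] /=; rewrite Xz eqxx implybb.
have drs : all (fun x => root p x && root p^`() x) rs.
  rewrite all_map all_filter; move: ds => /andP[Ts _]; apply: sub_all Ts.
  move=> X /asboolP[_ Xz [_ FX FjX]]; apply/implyP => Xy /=.
  have hFx := mderiv_homog ix hF.
  have := horner_top hF Xz Xy; have := horner_top hFx Xz Xy.
  rewrite FX (FjX ix) dF -lift_iz0 dFj -deriv_top // -/p lift_iz0 /root.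
  move=> /esym/eqP; rewrite mulf_eq0 expf_eq0 (negbTE Xy) andbF /= => ->.
  by move=> /esym/eqP; rewrite mulf_eq0 expf_eq0 (negbTE Xy) andbF /= => ->.
have le1 := double_roots_bound p0 urs drs.
rewrite size_map in le1.
have szp : (size p <= n.+1)%N by apply: size_poly.
have axis : all (fun X => [&& X iz == 0, X iy == 0, f@_(mnm2 n 0) == 0
    & f@_(mnm2 n.-1 1) == 0]) s2.
  rewrite all_filter; move: ds => /andP[Ts _]; apply: sub_all Ts.
  move=> X /asboolP[PX Xz [_ FX FjX]]; apply/implyP => /eqP Xy.
  have Xx : X ix != 0.
    by case: PX => i; case: (ord3P i) => ->; rewrite ?Xz ?Xy ?eqxx.
  have hFy := mderiv_homog iy hF.
  have := eval_on_axis hF Xz Xy; have := eval_on_axis hFy Xz Xy.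
  rewrite FX (FjX iy) dF -lift_iz1 dFj lift_iz1 Xz Xy eqxx /=.
  move=> /esym/eqP; rewrite mulf_eq0 expf_eq0 (negbTE Xx) andbF orbF.
  rewrite mcoeff_deriv mulrn_eq0 /= => e1.
  move=> /esym/eqP; rewrite mulf_eq0 expf_eq0 (negbTE Xx) andbF orbF => -> /=.
  move: e1; congr (f@_ _ == 0); apply/mnmP => k.
  by rewrite mnmDE mnm1E !mnmE; case: (ord2P k) => -> /=; rewrite ?addn0.
have szs2 : (size s2 <= 1)%N.
  have /andP[_] := dsf (fun X => X iy == 0); rewrite -/s2.
  case: (s2) axis => [|X [|Y r]] //= /and3P[].
  move=> /and4P[/eqP Xz /eqP Xy _ _] /and4P[/eqP Yz /eqP Yy _ _] _.
  move=> /andP[/andP[/negP[]]]; apply/proj_eqP => i j.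
  by case: (ord3P i) => ->; case: (ord3P j) => ->;
    rewrite ?Xz ?Yz ?Xy ?Yy ?mul0r ?mulr0.
have szp2 : (0 < size s2)%N -> (size p <= n.-1)%N.
  case: (s2) axis => //= X r /andP[/and4P[_ _ /eqP e1 /eqP e2] _] _.
  apply/leq_sizeP => j lej; rewrite coef_poly; case: ltnP => // ltj.
  have [->|jn] := eqVneq j n; first by rewrite subnn.
  have -> : j = n.-1 by apply/eqP; move: jn lej ltj n_gt0; clear; lia.
  by rewrite (_ : n - n.-1 = 1)%N //; move: n_gt0; clear; lia.
rewrite szs; move: (size s1) (size s2) (size p) szs2 szp2 szp le1 n_gt0; clear.
lia.
Qed.

End PointsAtInfinity.

(** * The degree of an invariant curve *)

Section InvariantCurveDegree.
Variable C : numClosedFieldType.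
Implicit Types (X : 'I_3 -> C) (s : seq ('I_3 -> C)).
Local Notation fx f := (f^`M(ord0)).
Local Notation fy f := (f^`M(ord_max)).

Variables (P Q f k : {mpoly C[2]}) (m n : nat).
Hypotheses (szP : msize P = m.+1) (szQ : msize Q = m.+1) (m_gt0 : (0 < m)%N).
Hypotheses (cop : no_common_factor P Q) (irr : mirreducible f).
Hypotheses (inv : P * fx f + Q * fy f = k * f).
Hypotheses (szf : msize f = n.+1) (n_gt1 : (1 < n)%N).

Let F := homogenize f.
Let G := F^`M(iy).
Let Pt := homogen iz m P.
Let Qt := homogen iz m Q.
Let Kt := homogen iz m.-1 k.
Let H := 'X_iz * Pt.

Lemma curve_neq0 : f != 0.
Proof. by rewrite -msize_poly_eq0 szf. Qed.

Lemma fy_neq0 : fy f != 0.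
Proof.
apply/eqP => /(irreducible_mderiv_eq0 irr); rewrite szf => -[n1].
by move: n_gt1; rewrite n1.
Qed.

Lemma homogenize_curve : F = homogen iz n f.
Proof. by rewrite /F homogenizeE szf. Qed.

Lemma curve_homog : F \is n.-homog.
Proof. by rewrite homogenize_curve; apply: homogen_homog; rewrite szf. Qed.

Lemma dehom_curve : dehomogenize iz F = f.
Proof. by rewrite homogenize_curve homogenK. Qed.

Lemma dehom_Fx : dehomogenize iz (F^`M(ix)) = fx f.
Proof. by rewrite -lift_iz0 -mderiv_dehomogenize dehom_curve. Qed.

Lemma dehom_G : dehomogenize iz G = fy f.
Proof. by rewrite /G -lift_iz1 -mderiv_dehomogenize dehom_curve. Qed.

Lemma form_neq0 : F != 0.
Proof. by apply: contraNneq curve_neq0 => F0; rewrite -dehom_curve F0 rmorph0. Qed.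

Lemma Pt_homog : Pt \is m.-homog.
Proof. by apply: homogen_homog; rewrite szP. Qed.

Lemma Qt_homog : Qt \is m.-homog.
Proof. by apply: homogen_homog; rewrite szQ. Qed.

Lemma X_homog (j : 'I_3) : 'X_j \is [in C[3], 1.-homog].
Proof. by rewrite dhomogX /= mdeg1. Qed.

Lemma H_homog : H \is m.+1.-homog.
Proof. by rewrite -[m.+1]add1n; apply: dhomogM (X_homog _) Pt_homog. Qed.

Lemma dehom_H : dehomogenize iz H = P.
Proof. by rewrite rmorphM /= homogenK dehomogenize_var mul1r. Qed.

Lemma not_dvd_small g : g != 0 -> (msize g < msize f)%N -> ~ exists r, g = r * f.
Proof.
move=> g0 lt [r gE]; have r0 : r != 0 by apply: contraNneq g0 => r0; rewrite gE r0 mul0r.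
have := msizeM_nz r0 curve_neq0; rewrite -gE => e.
have : (0 < msize r)%N by rewrite lt0n msize_poly_eq0.
have arith (a b c : nat) : (a < b -> a.+1 = c + b -> 0 < c -> False)%N by clear; lia.
exact: arith lt e.
Qed.

Lemma not_dvd_fy : ~ exists r, fy f = r * f.
Proof.
apply: not_dvd_small fy_neq0 _; rewrite (leq_ltn_trans (msize_mderiv _ _)) //.
by rewrite szf.
Qed.

(** If [f] divided [P], it would divide [Q f_y], hence [Q]. *)
Lemma not_dvd_P : ~ exists r, P = r * f.
Proof.
move=> [r PE]; have e : Q * fy f = (k - r * fx f) * f.
  by apply/(addrI (P * fx f)); rewrite inv PE; ring.
have [[q QE]|] := mirreducible_prime irr e; last exact: not_dvd_fy.
have /negP[] : ~~ nonconstant f by apply: (cop (u := r) (v := q)); rewrite mulrC.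
exact: irr.1.
Qed.

Lemma koszul_FG : koszul_exact n n.-1 F G.
Proof.
apply: (coprime_koszul (i := iz) curve_homog (mderiv_homog _ curve_homog)).
  by rewrite dehom_curve.
by rewrite dehom_curve dehom_G; apply: mirreducible_coprime irr not_dvd_fy.
Qed.

Lemma koszul_FH : koszul_exact n m.+1 F H.
Proof.
apply: (coprime_koszul (i := iz) curve_homog H_homog).
  by rewrite dehom_curve.
by rewrite dehom_curve dehom_H; apply: mirreducible_coprime irr not_dvd_P.
Qed.

Lemma koszul_PQ : koszul_exact m m Pt Qt.
Proof.
apply: (coprime_koszul (i := iz) Pt_homog Qt_homog); rewrite homogenK ?szP //.
by rewrite homogenK; apply: no_common_factor_coprime cop; rewrite -msize_poly_eq0 szP.
Qed.

Lemma msize_cofactor : (msize k <= m)%N.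
Proof.
have [->|k0] := eqVneq k 0; first by rewrite msize0.
have mulle (p q : {mpoly C[2]}) : (msize p <= m.+1)%N -> (msize q <= n)%N ->
    (msize (p * q) <= m + n)%N.
  have [->|p0] := eqVneq p 0; first by rewrite mul0r msize0.
  have [->|q0] := eqVneq q 0; first by rewrite mulr0 msize0.
  have arith (a b c : nat) : (a.+1 = b + c -> b <= m.+1 -> c <= n -> a <= m + n)%N.
    by clear; lia.
  exact: arith (msizeM_nz p0 q0).
have le : (msize (k * f) <= m + n)%N.
  rewrite -inv (leq_trans (msizeD_le _ _)) // geq_max.
  by rewrite !mulle ?szP ?szQ // (leq_trans (msize_mderiv _ _)) // szf.
have arith (a b : nat) : (a.+1 = b + n.+1 -> a <= m + n -> b <= m)%N by clear; lia.
by apply: arith le; rewrite -[n.+1]szf; apply: msizeM_nz k0 curve_neq0.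
Qed.

Lemma projective_invariance : Pt * F^`M(ix) + Qt * G = Kt * F.
Proof.
have e1 : (m + n.-1 = m.-1 + n)%N by lia.
apply: (@dehomogenize_inj _ iz (m + n.-1)).
- apply: rpredD.
    exact: dhomogM Pt_homog (mderiv_homog _ curve_homog).
  exact: dhomogM Qt_homog (mderiv_homog _ curve_homog).
- rewrite e1; apply: dhomogM curve_homog; apply: homogen_homog.
  by rewrite prednK // msize_cofactor.
- by rewrite rmorphD !rmorphM /= !homogenK dehom_Fx dehom_G dehom_curve.
Qed.

(** Modulo [F], invariance and Euler's identity turn each of [H F_x] and
    [H F_z] into a multiple of [F_y]. *)
Lemma residual_partial j : residual F G H F^`M(j).
Proof.
have inv3 := projective_invariance; have eul := euler_identity curve_homog.
have Px : Pt * F^`M(ix) = Kt * F - Qt * G by rewrite -inv3; ring.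
rewrite /residual /H; case: (ord3P j) => ->.
- exists ('X_iz * Kt), (- ('X_iz * Qt)).
  transitivity ('X_iz * (Pt * F^`M(ix))); first by ring.
  by rewrite Px; ring.
- by exists 0, ('X_iz * Pt); rewrite -/G; ring.
- exists (Pt * n%:R%:MP - 'X_ix * Kt), ('X_ix * Qt - 'X_iy * Pt).
  have zF : 'X_iz * F^`M(iz) = n%:R%:MP * F - 'X_ix * F^`M(ix) - 'X_iy * G.
    by rewrite mul_mpolyC -eul -/G; ring.
  transitivity (Pt * ('X_iz * F^`M(iz))); first by ring.
  rewrite zF; transitivity (Pt * n%:R%:MP * F - 'X_ix * (Pt * F^`M(ix)) - Pt * 'X_iy * G).
    by ring.
  by rewrite Px; ring.
Qed.

Lemma residual_zero_singular X : is_proj_point X ->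
  (forall g e, g \is e.-homog -> residual F G H g -> g.@[X] = 0) -> Sing f X.
Proof.
move=> PX res; split=> //.
  by apply: res curve_homog _; rewrite /residual mulrC; apply/in_idealM/in_ideal_gen1.
move=> j; apply: res (mderiv_homog j curve_homog) _; exact: residual_partial.
Qed.

(** Near a nonsingular point of the vector field, the invariant curve would be
    smooth. The equations [c(x) = 0] and [c(y) = 0] modulo the Jacobian ideal, that
    the descent on multiplicities needs, come from [F] and [F_y] being coprime. *)
Lemma finite_singular_stationary X : Sing f X -> X iz != 0 ->
  Pt.@[X] = 0 /\ Qt.@[X] = 0.
Proof.
move=> [_ FX FjX] Xz; set x := chart iz X.
have Xpow d : X iz ^+ d != 0 by rewrite expf_neq0.
have ev d (w : {mpoly C[3]}) : w \is d.-homog -> w.@[X] = 0 -> (dehomogenize iz w).@[x] = 0.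
  by move=> hw /eqP; rewrite (meval_chart hw Xz) mulf_eq0 (negbTE (Xpow _)) => /eqP.
have f0 : f.@[x] = 0 by rewrite -dehom_curve (ev _ _ curve_homog FX).
have fx0 : (fx f).@[x] = 0 by rewrite -dehom_Fx (ev _ _ (mderiv_homog _ curve_homog) (FjX ix)).
have fy0 : (fy f).@[x] = 0 by rewrite -dehom_G (ev _ _ (mderiv_homog _ curve_homog) (FjX iy)).
have elim_var (j : 'I_2) : exists2 c : {poly C}, c != 0 & jacobian_ideal f (poly_at c 'X_j).
  have [c c0 [g [r [[u [v gE]] e]]]] := in_ideal_poly_at curve_homog
    (mderiv_homog iy curve_homog) form_neq0 koszul_FG (X_homog (lift iz j)) (X_homog iz).
  exists c => //; exists (dehomogenize iz u), 0, (dehomogenize iz v).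
  have -> : poly_at c 'X_j = dehomogenize iz (poly_at c 'X_(lift iz j)).
    rewrite /poly_at -horner_map /= -map_poly_comp.
    congr (_.[_]).
      by apply: eq_map_poly => y /=; rewrite /dehomogenize comp_mpolyC.
    rewrite dehomogenizeX; congr 'X_[_]; apply/mnmP => i.
    by rewrite !mnmE (inj_eq lift_inj).
  rewrite e gE !rmorphD !rmorphM rmorphB /= rmorph1 dehomogenize_var subrr.
  by rewrite dehom_curve dehom_G; ring.
have [c0 c00 J0] := elim_var ord0; have [c1 c10 J1] := elim_var ord_max.
have := singular_point_stationary inv f0 fx0 fy0 c00 J0.
have := singular_point_stationary inv f0 fx0 fy0 c10 J1.
rewrite /= => Qx Px; split.
  by rewrite homogen_eval ?szP // Px mulr0.
by rewrite homogen_eval ?szQ // Qx mulr0.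
Qed.

(** The finite singular points are zeros of both [P] and [Q]; those at infinity
    are double points of the intersection with the line at infinity. *)
Lemma singular_points_bound s : distinct_points (@Sing C f) s ->
  ((size s).*2 <= (m * m).*2 + n)%N.
Proof.
move=> ds; pose s1 := [seq X <- s | X iz != 0]; pose s2 := [seq X <- s | X iz == 0].
have -> : size s = (size s1 + size s2)%N.
  by rewrite !size_filter addnC -(count_predC (fun X => X iz == 0) s).
have /andP[Ts ps] := ds.
have le1 : (size s1 <= m * m)%N.
  apply: (bezout_bound Pt_homog Qt_homog _ koszul_PQ).
    have P0 : P != 0 by rewrite -msize_poly_eq0 szP.
    by apply: contraNneq P0 => Pt0; rewrite -(homogenK iz m P) -/Pt Pt0 rmorph0.
  apply/andP; split; last exact: pairwise_filter.
  rewrite all_filter; apply: sub_all Ts => X /asboolP SX; apply/implyP => Xz.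
  by have [Px Qx] := finite_singular_stationary SX Xz; case: SX => PX _ _; apply/asboolP.
have le2 : ((size s2).*2 <= n)%N.
  apply: (singular_at_infinity_bound (ltnW n_gt1) szf); apply/andP; split.
    rewrite all_filter; apply: sub_all Ts => X /asboolP SX; apply/implyP => /eqP Xz.
    by apply/asboolP; split=> //; case: SX.
  exact: pairwise_filter.
by rewrite doubleD leq_add // leq_double.
Qed.

Lemma local_codim_singular K X : Sing f X ->
  (f_fy_number f X <= K%:Z%:E)%E -> local_codim_le F G X K.
Proof.
move=> [PX _ _]; have hG := mderiv_homog iy curve_homog.
have finish i : X i != 0 ->
    (intersection_number (dehomogenize i F) (dehomogenize i G) (chart i X) <= K%:Z%:E)%E ->
    local_codim_le F G X K.
  move=> Xi /intersection_number_le[d [loc le]].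
  apply: local_codim_leW (local_quotient_codim curve_homog hG Xi loc).
  by rewrite lez_nat in le.
rewrite /f_fy_number; case: ifP => [Xz|_].
  by move=> le; apply: (finish iz Xz); rewrite dehom_curve dehom_G.
rewrite /proj_intersection_number; case: pickP => [i Xi|none]; first exact: finish.
by case: PX => i; rewrite none.
Qed.

(** The residual inequality with [H = z P] of degree [m + 1]: the residual ideal
    [(F, F_y) : H] contains all partial derivatives of [F], hence only the singular
    points contribute, each by at most [K]. *)
Theorem degree_count K : (forall X, Sing f X -> (f_fy_number f X <= K%:Z%:E)%E) ->
  ((n * n.-1).*2 <= (n * m.+1).*2 + K * ((m * m).*2 + n))%N.
Proof.
move=> bound; have hG := mderiv_homog iy curve_homog.
have fin s : distinct_points (@Sing C f) s -> (size s <= m * m + n)%N.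
  by move=> /singular_points_bound; lia.
have [s ds sP] := exhaustive_points fin; have /andP[Ts _] := ds.
have main : (n * n.-1 <= n * m.+1 + K * size s)%N.
  apply: (residual_bound curve_homog hG H_homog form_neq0 koszul_FG koszul_FH).
  - by move=> X PX /(residual_zero_singular PX) /sP.
  - by apply: sub_all Ts => X /asboolP[PX _ _]; apply/asboolP.
  - apply: sub_all Ts => X /asboolP SX; apply/asboolP.
    exact: local_codim_singular SX (bound X SX).
have sz := singular_points_bound ds.
have Ksz : (K * (size s).*2 <= K * ((m * m).*2 + n))%N by rewrite leq_mul2l sz orbT.
rewrite (leq_trans _ (leq_add (leqnn _) Ksz)) // -!muln2 mulnA -mulnDl leq_mul2r.
by rewrite main orbT.
Qed.

End InvariantCurveDegree.

(** * The bound *)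

Lemma quadratic_root_bound (R : rcfType) (A B n : R) :
  n * (2 * n - A) <= B -> 4 * n <= A + Num.sqrt (A ^+ 2 + 8 * B).
Proof.
move=> le; rewrite -lerBlDl (le_trans (ler_norm _)) // -sqrtr_sqr ler_wsqrtr //.
by nra.
Qed.

Theorem theorem6 (R : realType) (P Q f : {mpoly (complex R)[2]})
    (m n : nat) (K : int) :
  (1 < m)%N ->
  has_degree P m -> has_degree Q m ->
  no_common_factor P Q ->
  invariant_curve P Q f ->
  has_degree f n ->
  0 <= K ->
  (forall X : 'I_3 -> complex R, Sing f X -> (f_fy_number f X <= K%:E)%E) ->
  (n%:R : R) <=
    (4 + 2 * m%:R + K%:~R
       + Num.sqrt ((4 + 2 * m%:R + K%:~R) ^+ 2 + 16 * K%:~R * m%:R ^+ 2)) / 4.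
Proof.
move=> m_gt1 /eqP szP /eqP szQ cop [irr [k inv]] /eqP szf.
case: K => // K _ bound; set A := 4 + 2 * m%:R + _.
rewrite ler_pdivlMr ?ltr0n // mulrC.
(* The derivative [f_y] may vanish when [n = 1], but then [4 n <= 4]. *)
have [n1|n_gt1] := leqP n 1.
  have A4 : 4 <= A by rewrite /A -addrA lerDl addr_ge0 ?mulr_ge0 ?ler0n.
  rewrite (@le_trans _ _ 4) // ?(le_trans A4) ?lerDl ?sqrtr_ge0 //.
  by rewrite ler_piMr ?ler0n // lern1.
have := degree_count szP szQ (ltnW m_gt1) cop irr inv szf n_gt1 bound.
rewrite -(ler_nat R) => count.
rewrite (_ : 16 * K%:~R * m%:R ^+ 2 = 8 * (2 * K%:R * m%:R ^+ 2)); last first.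
  by rewrite pmulrn; ring.
apply: quadratic_root_bound; move: count; rewrite -!muln2 /A.
case: n n_gt1 {szf} => // n _; rewrite /= !(natrD, natrM, mulrS) -pmulrn.
set mm : R := m%:R; set nn : R := n%:R; set KK : R := K%:R => count.
by nra.
Qed.
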